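(* If $X$ and $Y$ are two one-sided shift spaces which are conjugate, then there exists a $*$-isomorphism $\Phi$ from $\mathcal D_X\rtimes_{\alpha,\mathcal L}\mathbb N$ to $\mathcal D_Y\rtimes_{\alpha,\mathcal L}\mathbb N$ such that: (1) $\Phi(C(X))=C(Y)$, (2) $\Phi(\mathcal D_X)=\mathcal D_Y$, (3) $\Phi(\mathcal F_X)=\mathcal F_Y$, (4) $\Phi\circ\alpha_X=\alpha_Y\circ\Phi$ on $\mathcal D_X$, (5) $\Phi\circ\gamma_z=\gamma_z\circ\Phi$ for every $z\in\mathbb T$, (6) $\Phi\circ\mathcal L_X=\mathcal L_Y\circ\Phi$, (7) $\Phi\circ\lambda_X=\lambda_Y\circ\Phi$ on $\mathcal F_X$.
   Context: **Shift spaces.** $\mathfrak a$ is a finite set with the discrete topology, $\mathbb N_0=\{0,1,2,\dots\}$, and $\mathfrak a^{\mathbb N_0}$ has the product topology. The shift is $(\sigma(x))_i=x_{i+1}$. A one-sided shift space over the alphabet $\mathfrak a$ is a closed subset $X\subseteq\mathfrak a^{\mathbb N_0}$ with $\sigma(X)\subseteq X$; $\sigma=\sigma_X$ also denotes its restriction to $X$. Two one-sided shift spaces $X,Y$ (possibly over different alphabets) are conjugate if there is a homeomorphism $\phi:X\to Y$ with $\phi\circ\sigma_X=\sigma_Y\circ\phi$. $\mathfrak a^*$ is the set of finite words over $\mathfrak a$, including the empty word $\epsilon$; $|u|$ is the length of $u$. **The algebra $\mathcal D_X$.** For bounded functions $f:X\to\mathbb C$ put $\alpha(f)=\alpha_X(f)=f\circ\sigma$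 and $\mathcal L(f)(x)=\frac1{\#\sigma^{-1}(\{x\})}\sum_{y\in\sigma^{-1}(\{x\})}f(y)$ if $x\in\sigma(X)$, $\mathcal L(f)(x)=0$ if $x\notin\sigma(X)$. $\mathcal D_X$ is the smallest $C^*$-subalgebra of the $C^*$-algebra of bounded functions on $X$ that contains $C(X)$ and is closed under $\mathcal L$ and $\alpha$. **Exel's crossed product.** Let $A$ be a unital $C^*$-algebra, $\alpha:A\to A$ a $*$-endomorphism, and $\mathcal L:A\to A$ a transfer operator, i.e. a continuous positive linear map with $\mathcal L(\alpha(a)b)=a\mathcal L(b)$ for all $a,b\in A$. $\mathcal T(A,\alpha,\mathcal L)$ is the universal unital $C^*$-algebra generated by a copy of $A$ and an element $S$ subject to $Sa=\alpha(a)S$ and $S^*aS=\mathcal L(a)$ for all $a\in A$. A redundancy is a pair $(a,k)\in A\times\overline{ASS^*A}$ (closed linear span) with $abS=kbS$ for all $b\in A$. The crossed product $A\rtimes_{\alpha,\mathcal L}\mathbb N$ is the quotient of $\mathcal T(A,\alpha,\mathcal L)$ by the closed two-sided ideal generated by all differences $a-k$, where $(a,k)$ is a redundancy with $a\in\overline{A\alpha(A)A}$; $\rho$ denotes the quotient map. For $A=\mathcal D_X$ the restriction of $\rho$ to $\mathcal D_X$ is injective, and $C(X)\subseteq\mathcal D_X$ are viewed as subalgebras of $\mathcal D_X\rtimes_{\alpha,\mathcal L}\mathbb N$. **Generators and maps.** The function $f(x)=\#\sigma^{-1}(\{x\})$ belongs to $\mathcal D_X$. For $a\in\mathfrak a$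 let $C(a)=\{x\in X\mid x_0=a\}$ and $S_a=\rho\big(1_{C(a)}\alpha(f)^{1/2}S\big)$; for $u=u_1\cdots u_n\in\mathfrak a^*$ let $S_u=S_{u_1}\cdots S_{u_n}$, and let $S_\epsilon$ be the unit. These are partial isometries generating $\mathcal D_X\rtimes_{\alpha,\mathcal L}\mathbb N$. The gauge action $\gamma:\mathbb T\to\operatorname{Aut}(\mathcal D_X\rtimes_{\alpha,\mathcal L}\mathbb N)$ is determined by $\gamma_z(S_u)=z^{|u|}S_u$; the gauge action for $Y$ is also denoted $\gamma$. $\mathcal F_X$ is the $C^*$-subalgebra of $\mathcal D_X\rtimes_{\alpha,\mathcal L}\mathbb N$ generated by $\{S_vS_u^*S_uS_w^*\mid u,v,w\in\mathfrak a^*,\ |v|=|w|\}$. The map $\mathcal L_X$ on $\mathcal D_X\rtimes_{\alpha,\mathcal L}\mathbb N$ is $a\mapsto\rho(S)^*a\rho(S)$ (it extends $\mathcal L$ on $\mathcal D_X$). The map $\lambda_X:\mathcal F_X\to\mathcal F_X$ is $b\mapsto\big(\sum_{a\in\mathfrak a}S_a^*\big)\,b\,\big(\sum_{c\in\mathfrak a}S_c\big)$. The objects for $Y$ are defined in the same way. *)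

(* Defs.v *)
From HB Require Import structures.
From mathcomp Require Import all_boot all_order all_algebra.
From mathcomp Require Import all_classical all_reals all_analysis.
From mathcomp Require Import finmap.
From mathcomp.real_closed Require Import complex.

Set Implicit Arguments.
Unset Strict Implicit.
Unset Printing Implicit Defensive.

Import Order.TTheory GRing.Theory Num.Theory.
Import numFieldNormedType.Exports.

Local Open Scope classical_set_scope.
Local Open Scope ring_scope.

(* MathComp-Analysis, over an arbitrary realType R; the complex numbers are
   R[i], and functions to C are valued in R[i]^o, which carries the norm
   topology. *)

(* Unital complex C*-algebras.  The multiplication is a field of the mixin
   because a join of normed modules with (possibly trivial) rings below
   [numDomainType] cannot be added to the hierarchy; the ring structure is
   declared right after.  The zero algebra is allowed: it is the algebra of
   functions on the empty space. *)
HB.mixin Record isCstar (R : realType) A & CompleteNormedModule R[i] A := {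
  cstar_mul : A -> A -> A;
  cstar_one : A;
  star : A -> A;
  cstar_mulA : associative cstar_mul;
  cstar_mul1 : left_id cstar_one cstar_mul;
  cstar_mulr1 : right_id cstar_one cstar_mul;
  cstar_mulDl : left_distributive cstar_mul +%R;
  cstar_mulDr : right_distributive cstar_mul +%R;
  cstar_scaleAl : forall (c : R[i]) (a b : A),
    c *: cstar_mul a b = cstar_mul (c *: a) b;
  cstar_scaleAr : forall (c : R[i]) (a b : A),
    c *: cstar_mul a b = cstar_mul a (c *: b);
  starD : {morph star : a b / a + b};
  starZ : forall (c : R[i]) (a : A), star (c *: a) = c^* *: star a;
  starM : forall a b : A, star (cstar_mul a b) = cstar_mul (star b) (star a);
  starK : involutive star;
  cstar_normM : forall a b : A, `|cstar_mul a b| <= `|a| * `|b|;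
  cstar_norm_starM : forall a : A, `|cstar_mul (star a) a| = `|a| ^+ 2
}.

#[short(type="cstarType")]
HB.structure Definition Cstar (R : realType) :=
  {A of isCstar R A & CompleteNormedModule R[i] A}.

#[non_forgetful_inheritance]
HB.instance Definition _ (R : realType) (A : cstarType R) :=
  GRing.Zmodule_isPzRing.Build A
    cstar_mulA cstar_mul1 cstar_mulr1 cstar_mulDl cstar_mulDr.

Section CstarNotions.
Variable R : realType.

Record unital_star_hom (A B : cstarType R) (f : A -> B) : Prop := {
  star_hom_linear : linear f;
  star_hom_monoid : monoid_morphism f;
  star_hom_star : {morph f : a / star a}
}.

Definition star_isomorphism (A B : cstarType R) (f : A -> B) : Prop :=
  unital_star_hom f /\ bijective f.

Definition linear_subspace (A : cstarType R) (E : set A) : Prop :=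
  E 0 /\ forall (c : R[i]) x y, E x -> E y -> E (c *: x + y).

Record cstar_subalgebra (A : cstarType R) (E : set A) : Prop := {
  csub_closed : closed E;
  csub_linear : linear_subspace E;
  csub_mul : forall x y, E x -> E y -> E (x * y);
  csub_star : forall x, E x -> E (star x)
}.

Record closed_ideal (A : cstarType R) (E : set A) : Prop := {
  ideal_closed : closed E;
  ideal_linear : linear_subspace E;
  ideal_mull : forall a x, E x -> E (a * x);
  ideal_mulr : forall a x, E x -> E (x * a)
}.

Definition closed_span (A : cstarType R) : set A -> set A :=
  smallest (fun E => closed E /\ linear_subspace E).

Definition cstar_generated (A : cstarType R) : set A -> set A :=
  smallest (@cstar_subalgebra A).

Definition ideal_generated (A : cstarType R) : set A -> set A :=
  smallest (@closed_ideal A).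

End CstarNotions.

Section BoundedFunctions.
Variables (R : realType).
Local Notation C := (R[i]^o).

Lemma complex_complete (F : set_system C) :
  ProperFilter F -> cauchy F -> cvg F.
Proof.
move=> FF /cauchyP Fc.
have key (f : C -> R) : (forall z w, `|f z - f w|%:C%C <= `|z - w| :> R[i]) ->
    exists a : R, f @ F --> a.
  move=> fl; suff : cvg (f @ F) by move=> cf; exists (lim (f @ F)).
  apply: R_complete; apply: cauchy_exP => e e0.
  have [|z Fz] := Fc e%:C%C; first by rewrite ltcR.
  exists (f z).
  change (F (f @^-1` ball (f z) e)).
  apply: (@filterS _ F _ (ball z e%:C%C)) Fz => w.
  rewrite -!ball_normE /= => zw.
  by rewrite -ltcR; apply: le_lt_trans (fl _ _) zw.
have [z w|a Fa] := key (@complex.Re R).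
  by rewrite -raddfB /= normc_ge_Re.
have [z w|b Fb] := key (@complex.Im R).
  rewrite -raddfB /=.
  have := normc_ge_Re ((z - w) * 'i%C).
  rewrite ReiNIm normrN => /le_trans; apply.
  by rewrite normrM [X in _ * X]normc_def /= !expr0n /= add0r expr1n sqrtr1 mulr1.
apply/cvg_ex; exists (a +i* b)%C; apply/fcvgrPdist_lt => e e0.
have /complex_realP[r er] : e \is Num.real by rewrite gtr0_real.
move: e0; rewrite er ltcR => r0.
have r20 : 0 < r / 2 by rewrite divr_gt0.
move/cvgrPdist_lt : Fa => /(_ _ r20) Fa.
move/cvgrPdist_lt : Fb => /(_ _ r20) Fb.
near=> z.
have -> : (a +i* b)%C - z = (a - complex.Re z)%:C%C + 'i%C * (b - complex.Im z)%:C%C.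
  by rewrite [LHS]complexE !raddfB.
apply: (le_lt_trans (ler_normD _ _)).
rewrite normrM [X in X * _]normc_def /= !expr0n /= add0r expr1n sqrtr1 mul1r.
rewrite !normc_def /= !expr0n /= !addr0 !sqrtr_sqr -raddfD /= ltcR.
rewrite [ltRHS]splitr ltrD//.
- by near: z.
- by near: z.
Unshelve. all: by end_near. Qed.

Variable X : choiceType.

Definition is_bounded : {pred X -> C} :=
  fun f => `[< exists M : R, forall x, `|f x| <= M%:C%C >].

Record bfun := BFun {
  bfun_val :> X -> C;
  bfun_boundedP : bfun_val \in is_bounded }.

HB.instance Definition _ := [isSub for bfun_val].
HB.instance Definition _ := [Choice of bfun by <:].

Lemma is_bounded_submod : submod_closed is_bounded.
Proof.
split; first by apply/asboolP; exists 0 => x; rewrite normr0.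
move=> c f g /asboolP[M HM] /asboolP[N HN]; apply/asboolP.
exists (complex.Re `|c| * M + N) => x.
rewrite (le_trans (ler_normD _ _))// raddfD/= rmorphM/= lerD// ?HN//.
rewrite normrZ -[X in _ <= X * _]/(`|c|).
by apply: ler_wpM2l.
Qed.

HB.instance Definition _ :=
  GRing.isSubmodClosed.Build R[i] (X -> C) is_bounded is_bounded_submod.
HB.instance Definition _ := [SubChoice_isSubZmodule of bfun by <:].
HB.instance Definition _ := [SubZmodule_isSubLmodule of bfun by <:].


Definition bfun_norm (f : bfun) : C :=
  (sup [set complex.Re `|f x| | x in [set: X]])%:C%C.

Let normRe (z : C) : (complex.Re `|z|)%:C%C = `|z|.
Proof. by rewrite RRe_real. Qed.

Lemma le_bfun_norm (f : bfun) x : `|f x| <= bfun_norm f.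
Proof.
have /asboolP[M HM] := bfun_boundedP f.
rewrite -normRe lecR; apply: ub_le_sup; last by exists x.
by exists M => _ [y _ <-]; rewrite -lecR normRe.
Qed.

Lemma bfun_norm_le (f : bfun) (M : C) :
  0 <= M -> (forall x, `|f x| <= M) -> bfun_norm f <= M.
Proof.
move=> M0 fM; have Mr : M \is Num.real by rewrite ger0_real.
rewrite -(RRe_real Mr) lecR; set S := [set _ | _ in _].
have [->|S0] := eqVneq S set0; first by rewrite sup0 -ler0c RRe_real.
apply: ge_sup; first exact/set0P.
by move=> _ [y _ <-]; rewrite -lecR normRe RRe_real.
Qed.

Lemma bfun_norm_ge0 (f : bfun) : 0 <= bfun_norm f.
Proof.
rewrite ler0c; set S := [set _ | _ in _].
have [->|/set0P[_ [x _ _]]] := eqVneq S set0; first by rewrite sup0.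
by rewrite -ler0c (le_trans _ (le_bfun_norm f x)).
Qed.

Lemma bfun_eqP (f g : bfun) : (forall x, f x = g x) -> f = g.
Proof. by move=> fg; apply/val_inj/funext. Qed.

Lemma bfun_normD f g : bfun_norm (f + g) <= bfun_norm f + bfun_norm g.
Proof.
apply: bfun_norm_le => [|x]; first by rewrite addr_ge0 ?bfun_norm_ge0.
by rewrite (le_trans (ler_normD _ _))// lerD ?le_bfun_norm.
Qed.

Lemma bfun_normZ (c : R[i]) f : bfun_norm (c *: f) = `|c| * bfun_norm f.
Proof.
have H (d : R[i]) g : bfun_norm (d *: g) <= `|d| * bfun_norm g.
  apply: bfun_norm_le => [|x]; first by rewrite mulr_ge0 ?bfun_norm_ge0.
  by rewrite normrZ ler_wpM2l// le_bfun_norm.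
apply/eqP; rewrite eq_le H /=.
have [->|c0] := eqVneq c 0.
  by rewrite normr0 mul0r bfun_norm_ge0.
rewrite -ler_pdivlMl ?normr_gt0// -normfV.
by rewrite (le_trans _ (H _ _))// scalerA mulVf// scale1r.
Qed.

Lemma bfun_norm_eq0 f : bfun_norm f = 0 -> f = 0.
Proof.
move=> f0; apply: bfun_eqP => x; apply/eqP; rewrite -normr_eq0 eq_le normr_ge0 andbT.
by have := le_bfun_norm f x; rewrite f0.
Qed.

HB.instance Definition _ := Lmodule_isNormed.Build R[i] bfun
  bfun_normD bfun_normZ bfun_norm_eq0.

Lemma bfun_complete (F : set_system bfun) :
  ProperFilter F -> cauchy F -> cvg F.
Proof.
move=> FF /cauchyP Fc.
have cx x : cvg ((fun f : bfun => f x) @ F).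
  apply: complex_complete; apply: cauchy_exP => e e0.
  have [f Ff] := Fc e e0; exists (f x).
  change (F ((fun f : bfun => f x) @^-1` ball (f x) e)).
  apply: (@filterS _ F _ (ball f e)) Ff => g.
  rewrite -!ball_normE /= => fg.
  exact: le_lt_trans (le_bfun_norm (f - g) x) fg.
pose l x : C := lim ((fun f : bfun => f x) @ F).
have lP (e : C) : 0 < e -> F [set f : bfun | forall x, `|l x - f x| <= e].
  move=> e0; have e20 : 0 < e / 2 by rewrite divr_gt0.
  have e30 : 0 < e / 2 / 2 by rewrite divr_gt0.
  have [f Ff] := Fc _ e30.
  apply: (@filterS _ F _ (ball f (e / 2 / 2))) (Ff) => g.
  rewrite -ball_normE /= => fg x.
  have /cvgrPdist_lt/(_ _ e20) Fx := cx x.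
  have [h [lh]] := filter_ex (filterI Fx Ff).
  rewrite -ball_normE /= => fh.
  have -> : l x - g x = (l x - h x) + ((h x - f x) + (f x - g x)).
    by rewrite !addrA !subrK.
  have -> : e = e / 2 + (e / 2 / 2 + e / 2 / 2) by rewrite -!splitr.
  apply: (le_trans (ler_normD _ _)); apply: lerD; first exact: ltW.
  apply: (le_trans (ler_normD _ _)); apply: lerD.
    by rewrite distrC; apply: le_trans (le_bfun_norm (f - h) x) (ltW fh).
  exact: le_trans (le_bfun_norm (f - g) x) (ltW fg).
have lb : l \in is_bounded.
  have [f fl] := filter_ex (lP 1 ltr01).
  have /asboolP[M HM] := bfun_boundedP f; apply/asboolP.
  exists (1 + M) => x; rewrite -[l x](subrK (f x)) rmorphD /= rmorph1.
  by apply: (le_trans (ler_normD _ _)); apply: lerD.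
apply/cvg_ex; exists (BFun lb); apply/fcvgrPdist_lt => e e0.
have e20 : 0 < e / 2 by rewrite divr_gt0.
apply: filterS (lP _ e20) => f lf.
apply: (@le_lt_trans _ _ (e / 2)); last by rewrite gtr_pMr// invf_lt1 ?ltr1n.
exact: (@bfun_norm_le (BFun lb - f) _ (ltW e20) lf).
Qed.

HB.instance Definition _ := Uniform_isComplete.Build bfun bfun_complete.

Lemma is_bounded_mul (f g : bfun) : (fun x => f x * g x : C) \in is_bounded.
Proof.
apply/asboolP; exists (complex.Re (bfun_norm f * bfun_norm g)) => x.
rewrite RRe_real ?ger0_real ?mulr_ge0 ?bfun_norm_ge0// normrM.
by apply: ler_pM; rewrite ?normr_ge0 ?le_bfun_norm.
Qed.

Lemma is_bounded_one : (fun=> 1 : C) \in is_bounded.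
Proof. by apply/asboolP; exists 1 => x; rewrite normr1. Qed.

Lemma is_bounded_star (f : bfun) : (fun x => (f x)^* : C) \in is_bounded.
Proof.
have /asboolP[M HM] := bfun_boundedP f; apply/asboolP.
by exists M => x; rewrite norm_conjC.
Qed.

Definition bfun_mul (f g : bfun) : bfun := BFun (is_bounded_mul f g).
Definition bfun_one : bfun := BFun is_bounded_one.
Definition bfun_star (f : bfun) : bfun := BFun (is_bounded_star f).

Fact bfun_mulA : associative bfun_mul.
Proof. by move=> f g h; apply: bfun_eqP => x; exact: mulrA. Qed.
Fact bfun_mul1 : left_id bfun_one bfun_mul.
Proof. by move=> f; apply: bfun_eqP => x; exact: mul1r. Qed.
Fact bfun_mulr1 : right_id bfun_one bfun_mul.
Proof. by move=> f; apply: bfun_eqP => x; exact: mulr1. Qed.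
Fact bfun_mulDl : left_distributive bfun_mul +%R.
Proof. by move=> f g h; apply: bfun_eqP => x; exact: mulrDl. Qed.
Fact bfun_mulDr : right_distributive bfun_mul +%R.
Proof. by move=> f g h; apply: bfun_eqP => x; exact: mulrDr. Qed.
Fact bfun_scaleAl (c : R[i]) (f g : bfun) :
  c *: bfun_mul f g = bfun_mul (c *: f) g.
Proof. by apply: bfun_eqP => x; exact: mulrA. Qed.
Fact bfun_scaleAr (c : R[i]) (f g : bfun) :
  c *: bfun_mul f g = bfun_mul f (c *: g).
Proof. by apply: bfun_eqP => x; exact: mulrCA. Qed.
Fact bfun_starD : {morph bfun_star : f g / f + g}.
Proof. by move=> f g; apply: bfun_eqP => x; exact: rmorphD. Qed.
Fact bfun_starZ (c : R[i]) (f : bfun) : bfun_star (c *: f) = c^* *: bfun_star f.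
Proof. by apply: bfun_eqP => x; exact: rmorphM. Qed.
Fact bfun_starM (f g : bfun) :
  bfun_star (bfun_mul f g) = bfun_mul (bfun_star g) (bfun_star f).
Proof. by apply: bfun_eqP => x; rewrite /= rmorphM mulrC. Qed.
Fact bfun_starK : involutive bfun_star.
Proof. by move=> f; apply: bfun_eqP => x; exact: conjCK. Qed.
Fact bfun_normM (f g : bfun) : `|bfun_mul f g| <= `|f| * `|g|.
Proof.
apply: bfun_norm_le => [|x]; first by rewrite mulr_ge0 ?normr_ge0.
by rewrite /= normrM; apply: ler_pM; rewrite ?normr_ge0 ?le_bfun_norm.
Qed.
Fact bfun_norm_starM (f : bfun) : `|bfun_mul (bfun_star f) f| = `|f| ^+ 2.
Proof.
apply/eqP; rewrite eq_le; apply/andP; split.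
  apply: bfun_norm_le => [|x]; first by rewrite exprn_ge0.
  rewrite /= normrM norm_conjC -expr2.
  by apply: lerXn2r; rewrite ?nnegrE ?normr_ge0 ?le_bfun_norm.
have s0 : 0 <= `|bfun_mul (bfun_star f) f| by [].
rewrite -[leRHS]sqrtCK; apply: lerXn2r; rewrite ?nnegrE ?normr_ge0 ?sqrtC_ge0//.
apply: bfun_norm_le => [|x]; first by rewrite sqrtC_ge0.
rewrite -[leLHS]sqrCK ?normr_ge0// ler_sqrtC ?nnegrE ?exprn_ge0 ?normr_ge0//.
have := le_bfun_norm (bfun_mul (bfun_star f) f) x.
by rewrite /= normrM norm_conjC -expr2.
Qed.

HB.instance Definition _ := isCstar.Build R bfun
  bfun_mulA bfun_mul1 bfun_mulr1 bfun_mulDl bfun_mulDr bfun_scaleAl bfun_scaleAr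
  bfun_starD bfun_starZ bfun_starM bfun_starK bfun_normM bfun_norm_starM.

End BoundedFunctions.

Section Subalgebra.
Variables (R : realType) (A : cstarType R).

Record unital_csub := UnitalCsub {
  csub_set : set A;
  csub_cstar : cstar_subalgebra csub_set;
  csub_one : csub_set 1 }.

Variable E : unital_csub.

Definition in_csub : {pred A} := fun x => `[< csub_set E x >].

Record csub := Csub { csub_val :> A; csub_valP : csub_val \in in_csub }.

HB.instance Definition _ := [isSub for csub_val].
HB.instance Definition _ := [Choice of csub by <:].

Lemma in_csubP x : reflect (csub_set E x) (x \in in_csub).
Proof. exact: asboolP. Qed.

Lemma csubP (x : csub) : csub_set E x.
Proof. exact/in_csubP/csub_valP. Qed.

Lemma in_csub_submod : submod_closed in_csub.
Proof.
have [E0 EZD] := csub_linear (csub_cstar E).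
split=> [|c x y /in_csubP Ex /in_csubP Ey]; apply/in_csubP => //.
exact: EZD.
Qed.
HB.instance Definition _ :=
  GRing.isSubmodClosed.Build R[i] A in_csub in_csub_submod.
HB.instance Definition _ := [SubChoice_isSubZmodule of csub by <:].
HB.instance Definition _ := [SubZmodule_isSubLmodule of csub by <:].

Definition csub_norm (x : csub) : R[i] := `|csub_val x|.

Fact csub_normD x y : csub_norm (x + y) <= csub_norm x + csub_norm y.
Proof. exact: ler_normD. Qed.
Fact csub_normZ (c : R[i]) x : csub_norm (c *: x) = `|c| * csub_norm x.
Proof. exact: normrZ. Qed.
Fact csub_norm_eq0 x : csub_norm x = 0 -> x = 0.
Proof. by move=> /normr0_eq0 x0; exact: val_inj. Qed.
HB.instance Definition _ := Lmodule_isNormed.Build R[i] csub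
  csub_normD csub_normZ csub_norm_eq0.

Lemma csub_complete (F : set_system csub) :
  ProperFilter F -> cauchy F -> cvg F.
Proof.
move=> FF /cauchyP Fc.
have /cvg_ex[l Fl] : cvg (csub_val @ F).
  apply: cauchy_cvg; apply: cauchy_exP => e e0.
  have [x Fx] := Fc e e0; exists (csub_val x).
  change (F (csub_val @^-1` ball (csub_val x) e)).
  apply: (@filterS _ F _ (ball x e)) Fx => y.
  by rewrite -!ball_normE.
have El : l \in in_csub.
  apply/in_csubP; apply: (@closed_cvg _ _ F _ csub_val _ _ _ l Fl).
    exact: csub_closed (csub_cstar E).
  by apply: (@filterE _ F) => x; exact: csubP.
apply/cvg_ex; exists (Csub El); apply/fcvgrPdist_lt => e e0.
by move/cvgrPdist_lt : Fl => /(_ e e0).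
Qed.
HB.instance Definition _ := Uniform_isComplete.Build csub csub_complete.

Fact in_csubM (x y : csub) : csub_val x * csub_val y \in in_csub.
Proof. by apply/in_csubP/(csub_mul (csub_cstar E)); exact: csubP. Qed.
Fact in_csub1 : 1 \in in_csub.
Proof. by apply/in_csubP/csub_one. Qed.
Fact in_csub_star (x : csub) : star (csub_val x) \in in_csub.
Proof. by apply/in_csubP/(csub_star (csub_cstar E)); exact: csubP. Qed.

Definition csub_mulv (x y : csub) : csub := Csub (in_csubM x y).
Definition csub_onev : csub := Csub in_csub1.
Definition csub_starv (x : csub) : csub := Csub (in_csub_star x).

Fact csub_mulA : associative csub_mulv.
Proof. by move=> x y z; apply/val_inj; exact: mulrA. Qed.
Fact csub_mul1 : left_id csub_onev csub_mulv.
Proof. by move=> x; apply/val_inj; exact: mul1r. Qed.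
Fact csub_mulr1 : right_id csub_onev csub_mulv.
Proof. by move=> x; apply/val_inj; exact: mulr1. Qed.
Fact csub_mulDl : left_distributive csub_mulv +%R.
Proof. by move=> x y z; apply/val_inj; exact: mulrDl. Qed.
Fact csub_mulDr : right_distributive csub_mulv +%R.
Proof. by move=> x y z; apply/val_inj; exact: mulrDr. Qed.
Fact csub_scaleAl (c : R[i]) (x y : csub) :
  c *: csub_mulv x y = csub_mulv (c *: x) y.
Proof. by apply/val_inj; exact: cstar_scaleAl. Qed.
Fact csub_scaleAr (c : R[i]) (x y : csub) :
  c *: csub_mulv x y = csub_mulv x (c *: y).
Proof. by apply/val_inj; exact: cstar_scaleAr. Qed.
Fact csub_starD : {morph csub_starv : x y / x + y}.
Proof. by move=> x y; apply/val_inj; exact: starD. Qed.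
Fact csub_starZ (c : R[i]) (x : csub) : csub_starv (c *: x) = c^* *: csub_starv x.
Proof. by apply/val_inj; exact: starZ. Qed.
Fact csub_starM (x y : csub) :
  csub_starv (csub_mulv x y) = csub_mulv (csub_starv y) (csub_starv x).
Proof. by apply/val_inj; exact: starM. Qed.
Fact csub_starK : involutive csub_starv.
Proof. by move=> x; apply/val_inj; exact: starK. Qed.
Fact csub_normM (x y : csub) : `|csub_mulv x y| <= `|x| * `|y|.
Proof. exact: cstar_normM. Qed.
Fact csub_norm_starM (x : csub) : `|csub_mulv (csub_starv x) x| = `|x| ^+ 2.
Proof. exact: cstar_norm_starM. Qed.

HB.instance Definition _ := isCstar.Build R csub
  csub_mulA csub_mul1 csub_mulr1 csub_mulDl csub_mulDr csub_scaleAl csub_scaleAr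
  csub_starD csub_starZ csub_starM csub_starK csub_normM csub_norm_starM.

End Subalgebra.

(* Exel's crossed product of A by the endomorphism alpha and the transfer
   operator L.  The construction itself uses no property of alpha and L. *)
Section ExelCrossedProduct.
Variables (R : realType) (A : cstarType R) (alpha L : A -> A).

(* The copy of A in the universal unital C*-algebra contains its unit. *)
Record toeplitz_relations (T : cstarType R) (j : A -> T) (s : T) : Prop := {
  toeplitz_hom : unital_star_hom j;
  toeplitz_alpha : forall a, s * j a = j (alpha a) * s;
  toeplitz_L : forall a, star s * j a * s = j (L a) }.

Record universal_toeplitz (T : cstarType R) (iota : A -> T) (S : T) : Prop := {
  toeplitz_rel : toeplitz_relations iota S;
  toeplitz_gen : cstar_generated (range iota `|` [set S]) = [set: T];
  toeplitz_univ : forall (B : cstarType R) (j : A -> B) (s : B),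
    toeplitz_relations j s ->
    exists theta : T -> B, [/\ unital_star_hom theta,
      (forall a, theta (iota a) = j a) & theta S = s] }.

Definition redundancy (T : cstarType R) (iota : A -> T) (S : T) (a : A) (k : T)
    : Prop :=
  closed_span [set x | exists b c, x = iota b * S * star S * iota c] k /\
  forall b, iota a * iota b * S = k * iota b * S.

Definition redundancy_ideal (T : cstarType R) (iota : A -> T) (S : T) : set T :=
  ideal_generated [set x | exists a k,
    [/\ redundancy iota S a k,
        closed_span [set y | exists b c d, y = b * alpha c * d] a
      & x = iota a - k]].

(* A model of the crossed product: a universal Toeplitz algebra T(A, alpha, L)
   together with its quotient by the redundancy ideal, a quotient being a
   surjective *-homomorphism with that kernel.  Both are determined up to a
   unique isomorphism. *)
Structure crossed_product := CrossedProduct {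
  cp_toeplitz : cstarType R;
  cp_iota : A -> cp_toeplitz;
  cp_S : cp_toeplitz;
  cp_universal : universal_toeplitz cp_iota cp_S;
  cp_alg :> cstarType R;
  cp_rho : cp_toeplitz -> cp_alg;
  cp_rho_hom : unital_star_hom cp_rho;
  cp_rho_surj : range cp_rho = [set: cp_alg];
  cp_rho_ker : forall x,
    cp_rho x = 0 <-> redundancy_ideal cp_iota cp_S x }.

Definition cp_embed (B : crossed_product) (a : A) : B := cp_rho (cp_iota B a).

Definition cp_isometry (B : crossed_product) : B := cp_rho (cp_S B).

End ExelCrossedProduct.
Arguments cp_embed {R A alpha L} B a.
Arguments cp_isometry {R A alpha L} B.

Section ShiftSpaces.
Variable (a : finType).

Definition full_shift := prod_topology (fun _ : nat => discrete_topology a).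

Definition shift_map (x : full_shift) : full_shift := fun i => x i.+1.

Record shift_space := ShiftSpace {
  points :> set full_shift;
  points_closed : closed points;
  points_shift : shift_map @` points `<=` points }.

Lemma sigma_subproof (X : shift_space) (x : X) :
  shift_map (set_val x) \in (X : set full_shift).
Proof.
by apply/mem_set/points_shift; exists (set_val x) => //; exact: set_valP.
Qed.

Definition sigma (X : shift_space) (x : X) : X :=
  exist _ (shift_map (set_val x)) (sigma_subproof x).

End ShiftSpaces.

Definition conjugate (a b : finType) (X : shift_space a) (Y : shift_space b)
    : Prop :=
  exists (phi : X -> Y) (psi : Y -> X),
    [/\ cancel phi psi, cancel psi phi, continuous phi, continuous psi
      & forall x, phi (sigma x) = sigma (phi x)].

Section FunctionAlgebras.
Variables (R : realType) (a : finType) (X : shift_space a).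
Local Notation C := (R[i]^o).

Definition fiber (x : X) : set X := [set y | sigma y = x].

Definition nfiber (x : X) : nat := #|` fset_set (fiber x)|%fset.

Lemma fiber_head (x y z : X) : fiber x y -> fiber x z ->
  set_val y 0%N = set_val z 0%N -> y = z.
Proof.
rewrite /fiber /= => <- /(congr1 (fun u : X => set_val u)) /= yz yz0.
apply/val_inj/funext => -[//|n].
by rewrite /= in yz *; have /= := congr1 ((fun u : full_shift a => u n)) yz.
Qed.

Lemma finite_fiber x : finite_set (fiber x).
Proof.
pose h (y : X) : option a := if pselect (fiber x y) then Some (set_val y 0%N) else None.
have -> : fiber x = h @^-1` [set~ None].
  apply/seteqP; split=> y; rewrite /h /=; case: pselect => //.
apply: finite_preimage; last exact: finite_finset.
move=> y z /set_mem + /set_mem; rewrite /h /=.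
case: pselect => [py|_ []] //; case: pselect => [pz|_ _ []] //.
move=> _ _ [yz]; exact: (fiber_head py pz yz).
Qed.

Lemma leq_nfiber x : (nfiber x <= #|a|)%N.
Proof.
pose hd (y : X) : a := set_val y 0%N.
have us : uniq [seq hd y | y <- fset_set (fiber x)].
  rewrite map_inj_in_uniq ?fset_uniq// => y z.
  rewrite !(in_fset_set (finite_fiber x)) => /set_mem py /set_mem pz.
  by move=> yz; exact: (fiber_head py pz yz).
rewrite /nfiber -(size_map hd) -(card_uniqP us); exact: max_card.
Qed.


Lemma is_bounded_alpha (f : bfun R X) : (fun x => f (sigma x)) \in @is_bounded R X.
Proof.
by have /asboolP[M HM] := bfun_boundedP f; apply/asboolP; exists M.
Qed.

Definition alphaB (f : bfun R X) : bfun R X := BFun (is_bounded_alpha f).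

(* The fibers are finite; off the image of sigma the fiber is empty and the
   formula gives 0. *)
Definition transfer (f : X -> C) (x : X) : C :=
  (nfiber x)%:R^-1 * \sum_(y \in fiber x) f y.

Lemma is_bounded_transfer (f : bfun R X) : transfer f \in @is_bounded R X.
Proof.
have /asboolP[M HM] := bfun_boundedP f; apply/asboolP; exists M => x.
rewrite /transfer fsbig_finite; last exact: finite_fiber.
rewrite normrM normfV normr_nat.
have [n0|n0] := posnP (nfiber x).
  by rewrite n0 invr0 mul0r (le_trans (normr_ge0 _) (HM x)).
rewrite ler_pdivrMl ?ltr0n// mulr_natl.
apply: (le_trans (ler_norm_sum _ _ _)).
apply: (@le_trans _ _ (\sum_(y <- fset_set (fiber x)) M%:C%C)).
  exact: ler_sum.
by rewrite big_const_seq count_predT iter_addr_0.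
Qed.

Definition transferB (f : bfun R X) : bfun R X := BFun (is_bounded_transfer f).

Definition continuous_funs : set (bfun R X) := [set f | continuous (f : X -> C)].

End FunctionAlgebras.

Lemma lagrange (K : fieldType) (u : seq K) (h : K -> K) (y : K) :
  uniq u -> y \in u ->
  \sum_(v <- u) h v * \prod_(w <- u | w != v) ((v - w)^-1 * (y - w)) = h y.
Proof.
move=> uu yu; rewrite (bigD1_seq y)//= big1 => [|w wy]; last first.
  by rewrite mulVf// subr_eq0 eq_sym.
rewrite mulr1 big1_seq ?addr0// => v /andP[vy _].
by rewrite -big_filter (bigD1_seq y) ?filter_uniq ?mem_filter 1?eq_sym ?vy//= subrr mulr0 mul0r mulr0.
Qed.

Section FiniteCalculus.
Variables (R : realType) (X : choiceType).
Local Notation C := (R[i]^o).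
Local Notation B := (bfun R X : cstarType R).

Lemma csub_finite_calculus (E : set B) (s : seq C) (h : C -> C) (f g : B) :
  cstar_subalgebra E -> E 1 -> E f -> (forall x, f x \in s) -> (forall x, g x = h (f x)) -> E g.
Proof.
move=> EC E1 Ef fs gh.
have [E0 EZD] := csub_linear EC.
have EZ (c : R[i]) k : E k -> E (c *: k).
  by move=> Ek; rewrite -[_ *: _]addr0; exact: EZD.
have ED k k' : E k -> E k' -> E (k + k').
  by move=> Ek Ek'; rewrite -[k]scale1r; exact: EZD.
pose u := undup s.
have prodE v (t : seq C) : exists2 p : B, E p &
    forall x, p x = \prod_(w <- t | w != v) ((v - w)^-1 * (f x - w)).
  elim: t => [|w t [p Ep pE]]; first by exists (1 : B) => // x; rewrite big_nil.
  have [wv|wv] := eqVneq w v.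
    by exists p => // x; rewrite big_cons wv eqxx /= pE.
  exists ((v - w)^-1 *: (f + (- w) *: (1 : B)) * p : B).
    by apply: (csub_mul EC) => //; apply/EZ/ED => //; exact: EZ.
  move=> x; rewrite big_cons wv -pE.
  change ((v - w)^-1 * (f x + (- w) * 1) * p x =
          (v - w)^-1 * (f x - w) * p x).
  by rewrite mulr1.
have sumE (t : seq C) : exists2 q : B, E q & forall x, q x =
    \sum_(v <- t) h v * \prod_(w <- u | w != v) ((v - w)^-1 * (f x - w)).
  elim: t => [|v t [q Eq qE]]; first by exists (0 : B) => // x; rewrite big_nil.
  have [p Ep pE] := prodE v u.
  exists (h v *: p + q); first by apply: ED => //; exact: EZ.
  by move=> x; rewrite big_cons -qE -pE.
have [q Eq qE] := sumE u.
suff -> : g = q by [].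
apply: bfun_eqP => x; rewrite qE gh; apply/esym.
by apply: (@lagrange R[i]); rewrite ?undup_uniq ?mem_undup.
Qed.

End FiniteCalculus.

Section DX.
Variables (R : realType) (a : finType) (X : shift_space a).
Local Notation C := (R[i]^o).
Local Notation B := (bfun R X : cstarType R).

Definition DX_closed (E : set B) : Prop :=
  [/\ cstar_subalgebra E, @alphaB R a X @` E `<=` E
    & @transferB R a X @` E `<=` E].

Definition DX_set : set B := smallest DX_closed (@continuous_funs R a X).

Lemma DX_setP : DX_closed DX_set.
Proof.
split=> [|_ [f Df <-] E|_ [f Df <-] E]; last 2 first.
- by move=> HE; have [[_ Ea _] _] := HE; apply: Ea; exists f => //; exact: Df.
- by move=> HE; have [[_ _ Et] _] := HE; apply: Et; exists f => //; exact: Df.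
split.
- by apply: closed_bigI => E [[/csub_closed]].
- split=> [E [[/csub_linear[]]]//|c x y Dx Dy E HE].
  have [[EC _ _] _] := HE.
  by apply: (csub_linear EC).2; [exact: Dx|exact: Dy].
- move=> x y Dx Dy E HE; have [[EC _ _] _] := HE.
  by apply: (csub_mul EC); [exact: Dx|exact: Dy].
- move=> x Dx E HE; have [[EC _ _] _] := HE.
  by apply: (csub_star EC); exact: Dx.
Qed.

Lemma DX_continuous : @continuous_funs R a X `<=` DX_set.
Proof. exact: sub_gen_smallest. Qed.

Lemma DX_one : DX_set 1.
Proof. apply: DX_continuous; exact: (@cst_continuous X C 1). Qed.

Lemma DX_cstar : cstar_subalgebra DX_set.
Proof. by have [] := DX_setP. Qed.

Definition DX : unital_csub B := UnitalCsub DX_cstar DX_one.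

Lemma alphaD_subproof (f : csub DX) : alphaB (csub_val f) \in in_csub DX.
Proof.
apply/in_csubP; have [_ Da _] := DX_setP.
by apply: Da; exists (csub_val f) => //; exact: (csubP f).
Qed.
Definition alphaD (f : csub DX) : csub DX := Csub (alphaD_subproof f).

Lemma transferD_subproof (f : csub DX) : transferB (csub_val f) \in in_csub DX.
Proof.
apply/in_csubP; have [_ _ Dt] := DX_setP.
by apply: Dt; exists (csub_val f) => //; exact: (csubP f).
Qed.
Definition transferD (f : csub DX) : csub DX := Csub (transferD_subproof f).

Lemma is_bounded_cylinder (c : a) :
  (fun x : X => (set_val x 0%N == c)%:R : C) \in @is_bounded R X.
Proof.
apply/asboolP; exists 1 => x; case: eqP => _; first by rewrite normr1.
by rewrite normr0 ler01.
Qed.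

Definition cylinder (c : a) : bfun R X := BFun (is_bounded_cylinder c).

Lemma continuous_cylinder c : @continuous_funs R a X (cylinder c).
Proof.
move=> x; pose ev (y : X) : discrete_topology a := set_val y 0%N.
have ce : continuous ev.
  move=> y; apply: (@continuous_comp _ _ _ (set_val : X -> full_shift a)
    (@proj nat (fun=> discrete_topology a) 0%N)).
    exact: initial_continuous.
  exact: proj_continuous.
apply: (@continuous_comp _ _ _ ev (fun b => (b == c)%:R : C)); first exact: ce.
move=> U nU; apply/principal_filterP => /=; exact: nbhs_singleton nU.
Qed.

Lemma nfiber_values (k : nat) : (k <= #|a|)%N ->
  (k%:R : C) \in [seq n%:R | n <- iota 0 #|a|.+1].
Proof. by move=> ka; apply: map_f; rewrite mem_iota. Qed.

Lemma is_bounded_nfiber : (fun x : X => (nfiber x)%:R : C) \in @is_bounded R X.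
Proof.
apply/asboolP; exists #|a|%:R => x.
by rewrite normr_nat rmorph_nat ler_nat leq_nfiber.
Qed.

Definition nfiberB : bfun R X := BFun is_bounded_nfiber.

Definition head_count (c : a) (x : X) : nat :=
  count (fun y : X => set_val y 0%N == c) (fset_set (fiber x)).

Lemma head_count_le1 c x : (head_count c x <= 1)%N.
Proof.
rewrite /head_count -size_filter.
case E : [seq _ <- _ | _] => [//|y s].
have yin : y \in [seq y : X <- fset_set (fiber x) | set_val y 0%N == c].
  by rewrite E mem_head.
rewrite -E; apply: (@uniq_leq_size _ _ [:: y]).
  by rewrite filter_uniq// fset_uniq.
move: yin; rewrite mem_filter => /andP[/eqP yc].
rewrite (in_fset_set (finite_fiber x)) => /set_mem py.
move=> z; rewrite mem_filter => /andP[/eqP zc].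
rewrite (in_fset_set (finite_fiber x)) => /set_mem pz.
by rewrite mem_seq1; apply/eqP/(fiber_head pz py); rewrite zc yc.
Qed.

Lemma nfiber_sum x : nfiber x = (\sum_(c : a) head_count c x)%N.
Proof.
rewrite /nfiber -sum1_size; under [RHS]eq_bigr do rewrite /head_count -sum1_count.
rewrite (exchange_big_dep xpredT)//=; apply: eq_bigr => y _.
by rewrite (big_pred1 (set_val y 0%N))// => c; rewrite eq_sym.
Qed.

Lemma transfer_cylinder c x :
  transferB (cylinder c) x = (nfiber x)%:R^-1 * (head_count c x)%:R.
Proof.
rewrite /= /transfer fsbig_finite; last exact: finite_fiber.
congr (_ * _); rewrite /head_count -sum1_count natr_sum.
by rewrite [RHS]big_mkcond; apply: eq_bigr => y _ /=; case: eqP.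
Qed.

Lemma DX_nfiber : DX_set nfiberB.
Proof.
have [DC _ Dt] := DX_setP; have [D0 DZD] := csub_linear DC.
pose nz (z : C) : C := (z != 0)%:R.
have DT c : DX_set (transferB (cylinder c)).
  by apply: Dt; exists (cylinder c) => //; exact: (DX_continuous (continuous_cylinder (c:=c))).
have ex c : exists2 g : B, DX_set g & forall x, g x = nz (transferB (cylinder c) x).
  have bg : (fun x => nz (transferB (cylinder c) x)) \in @is_bounded R X.
    apply/asboolP; exists 1 => x; rewrite /nz normr_nat.
    by case: (_ != 0).
  exists (BFun bg) => //.
  apply: (@csub_finite_calculus R X DX_set
    [seq (n%:R : C)^-1 * m%:R | n <- iota 0 #|a|.+1, m <- iota 0 2] nz
    (transferB (cylinder c))) => //; first exact: DX_one.
  move=> x; rewrite transfer_cylinder; apply: (@allpairs_f nat nat C (fun n m => (n%:R : C)^-1 * m%:R));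
    rewrite mem_iota/= add0n.
    by rewrite ltnS leq_nfiber.
  by rewrite ltnS head_count_le1.
have [g Dg gE] : exists2 g : a -> B, forall c, DX_set (g c) &
    forall c x, g c x = nz (transferB (cylinder c) x).
  exists (fun c => s2val (cid2 (ex c))) => c; first exact: (s2valP (cid2 (ex c))).
  exact: (s2valP' (cid2 (ex c))).
have sumD (s : seq a) : exists2 f : B, DX_set f &
    forall x, f x = \sum_(c <- s) g c x.
  elim: s => [|c s [f Df fE]]; first by exists (0 : B) => // x; rewrite big_nil.
  exists (1 *: g c + f : B); first exact: DZD.
  by move=> x; rewrite big_cons -fE scale1r.
have [f Df fE] := sumD (index_enum a).
suff -> : nfiberB = f by [].
apply: bfun_eqP => x; rewrite fE /= nfiber_sum natr_sum; apply: eq_bigr => c _.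
rewrite gE transfer_cylinder /nz.
have := head_count_le1 c x.
have : (head_count c x <= nfiber x)%N by rewrite (nfiber_sum x) (bigD1 c)//= leq_addr.
case: (head_count c x) => [|[|//]]; first by rewrite mulr0 eqxx.
by move=> n0 _; rewrite mulr1 invr_eq0 pnatr_eq0 -lt0n n0.
Qed.

Lemma is_bounded_sqrt_alpha :
  (fun x : X => sqrtC (nfiber (sigma x))%:R : C) \in @is_bounded R X.
Proof.
apply/asboolP; exists (complex.Re (sqrtC #|a|%:R)) => x.
have s0 : 0 <= sqrtC (#|a|%:R : R[i]) by rewrite sqrtC_ge0.
rewrite RRe_real ?ger0_real// ger0_norm ?sqrtC_ge0// ler_sqrtC ?nnegrE//.
by rewrite ler_nat leq_nfiber.
Qed.

Definition sqrt_alpha_nfiber : bfun R X := BFun is_bounded_sqrt_alpha.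

Lemma DX_sqrt_alpha_nfiber : DX_set sqrt_alpha_nfiber.
Proof.
have [DC Da _] := DX_setP.
apply: (csub_finite_calculus (h := fun z => sqrtC z) DC DX_one).
- by apply: Da; exists nfiberB => //; exact: DX_nfiber.
- move=> x; apply: nfiber_values; exact: leq_nfiber.
- by [].
Qed.

Lemma generator_subproof (c : a) :
  (cylinder c : B) * sqrt_alpha_nfiber \in in_csub DX.
Proof.
apply/in_csubP; have [DC _ _] := DX_setP.
apply: (csub_mul DC); last exact: DX_sqrt_alpha_nfiber.
exact: (DX_continuous (continuous_cylinder (c:=c))).
Qed.
(* 1_C(c) alpha(f)^(1/2), where f x is the cardinality of the fiber over x. *)
Definition generator_coef (c : a) : csub DX := Csub (generator_subproof c).

End DX.

Section ShiftCrossedProduct.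
Variables (R : realType) (a : finType) (X : shift_space a).

Definition shift_crossed_product : Type :=
  crossed_product (@alphaD R a X) (@transferD R a X).

Variable B : shift_crossed_product.

Definition CX_image : set B :=
  [set cp_embed B f | f in [set f : csub (DX R X) | continuous_funs (csub_val f)]].

Definition DX_image : set B := range (cp_embed B).

Definition S_letter (c : a) : B :=
  cp_rho (cp_iota B (generator_coef R X c) * cp_S B).

Definition S_word (u : seq a) : B := \prod_(c <- u) S_letter c.

Definition FX : set B :=
  cstar_generated [set x | exists u v w : seq a, size v = size w /\
    x = S_word v * star (S_word u) * S_word u * star (S_word w)].

Definition LX (b : B) : B := star (cp_isometry B) * b * cp_isometry B.

Definition lambdaX (b : B) : B :=
  (\sum_(c : a) star (S_letter c)) * b * (\sum_(c : a) S_letter c).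

(* The circle is the set of complex numbers of modulus 1; the values on the
   S_word u determine the automorphism. *)
Definition gauge_action (gamma : R[i] -> B -> B) : Prop :=
  forall z : R[i], `|z| = 1 ->
    star_isomorphism (gamma z) /\
    forall u : seq a, gamma z (S_word u) = z ^+ size u *: S_word u.

End ShiftCrossedProduct.
Arguments CX_image {R a X} B.
Arguments DX_image {R a X} B.
Arguments FX {R a X} B.
Arguments gauge_action {R a X} B gamma.

(* Main.v *)
(* Composition with phi^-1 carries D_X onto D_Y compatibly with alpha and L, so
   universality gives an isomorphism Phi of crossed products that sends
   rho(S) to rho(S).  Everything in the statement that does not mention the
   alphabet is then immediate, and it remains to free the other data from the
   letters:
   - the sum of the S_c is rho(alpha(f)^(1/2) S), which settles lambda;
   - S_c S_c^* = 1_C(c) by a redundancy, and D is generated by the 1_C(c) under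
     alpha and the maps q |-> S_c^* q S_c; hence the gauge action fixes D and
     multiplies rho(S) by z;
   - by the same induction S_v q S_w^* lies in F_X whenever q is in D and
     |v| = |w|, so that F_X is generated by the elements S^n q S^n^*. *)
Require Import Defs.
From mathcomp Require Import all_boot all_order all_algebra.
From mathcomp Require Import all_classical all_reals all_analysis.
From mathcomp Require Import finmap.
From mathcomp.real_closed Require Import complex.

Set Implicit Arguments.
Unset Strict Implicit.
Unset Printing Implicit Defensive.

Import Order.TTheory GRing.Theory Num.Theory.
Import numFieldNormedType.Exports.

Local Open Scope classical_set_scope.
Local Open Scope ring_scope.

(** * Automatic continuity of star-homomorphisms *)

(** Closed spans, closed ideals and generated C*-algebras are all smallest closed sets with some
    property, so they are carried along a homomorphism by taking preimages. That needs continuity,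
    which [unital_star_hom] does not include; it is derived from the C*-identity alone. The other
    obstacle is that conjugate shifts may have different alphabets: a word over the first has no
    counterpart over the second, so whatever is phrased by words has to be rewritten through D,
    alpha and rho(S) before Phi can transport it. The bridge in both directions is that alpha(f) is
    invertible in D, which makes rho(S) a coefficient from D times the sum of the letters. *)

Section CstarBasics.
Variable R : realType.
Implicit Types A B : cstarType R.

Lemma cstarM A (x y : A) : star (x * y) = star y * star x.
Proof. exact: starM. Qed.

Lemma star1 A : star (1 : A) = 1.
Proof. by rewrite -[RHS](starK (1 : A)) -[in RHS](mulr1 (star 1)) cstarM starK mulr1. Qed.

Lemma star0 A : star (0 : A) = 0.
Proof. by rewrite -[0 in LHS](scale0r (0 : A)) starZ conjC0 scale0r. Qed.

Lemma star_sum A (I : Type) (r : seq I) (F : I -> A) :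
  star (\sum_(i <- r) F i) = \sum_(i <- r) star (F i).
Proof. by apply: (big_morph _ (@starD _ A) (star0 A)). Qed.

Lemma cstarZl A (c : R[i]) (x y : A) : (c *: x) * y = c *: (x * y).
Proof. by rewrite [RHS]cstar_scaleAl. Qed.

Lemma cstarZr A (c : R[i]) (x y : A) : x * (c *: y) = c *: (x * y).
Proof. by rewrite [RHS]cstar_scaleAr. Qed.

Lemma cstarN A (x : A) : star (- x) = - star x.
Proof. by rewrite -scaleN1r starZ rmorphN rmorph1 scaleN1r. Qed.

Lemma cstarB A (x y : A) : star (x - y) = star x - star y.
Proof. by rewrite starD cstarN. Qed.

Lemma le_norm_cstarM A (x y : A) : `|x * y| <= `|x| * `|y|.
Proof. exact: cstar_normM. Qed.

Lemma norm_starM A (x : A) : `|star x * x| = `|x| ^+ 2.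
Proof. exact: cstar_norm_starM. Qed.

Lemma norm_star A (x : A) : `|star x| = `|x|.
Proof.
have le (y : A) : `|y| <= `|star y|.
  have [->|y0] := eqVneq y 0; first by rewrite normr0.
  by rewrite -(@ler_pM2r _ `|y|) ?normr_gt0// -expr2 -norm_starM le_norm_cstarM.
by apply/eqP; rewrite eq_le le andbT -{2}[x]starK le.
Qed.

Lemma norm_isometry A (u : A) : star u * u = 1 -> `|u| <= 1.
Proof.
move=> uu; have n1 : `|1 : A| <= 1.
  (* The zero algebra is allowed, and its unit has norm 0; otherwise the C*-identity forces norm
     1. *)
  have [->|n0] := eqVneq `|1 : A| 0; first by rewrite ler01.
  have := norm_starM (1 : A); rewrite star1 mulr1 expr2 => /(congr1 ( *%R^~ `|1 : A|^-1)).
  by rewrite mulfV// mulfK// => ->.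
by rewrite -(@ler_pXn2r _ 2)// ?nnegrE// expr1n -norm_starM uu.
Qed.

(** Passes identities to a limit: an expression that vanishes at the iterates differs from its value
    at the limit by at most [K] error terms of size e. *)
Lemma norm_small_eq0 A (x : A) (K : R[i]) :
  (forall e : R[i], 0 < e -> `|x| <= K * e) -> x = 0.
Proof.
move=> xK; apply/eqP; rewrite -normr_le0; apply/ler_addgt0Pr => e e0.
rewrite add0r; have K0 : 0 <= K.
  by have := le_trans (normr_ge0 x) (xK 1 ltr01); rewrite mulr1.
have K1 : 0 < K + 1 by rewrite ltr_wpDl.
have := xK (e / (K + 1)) (divr_gt0 e0 K1) => /le_trans; apply.
by rewrite mulrCA ger_pMr// ler_pdivrMr// mul1r lerDl ler01.
Qed.

(** A fixed point z of y |-> (a^2 + y^2)/2 satisfies (1 - z)^2 = 1 - a^2. The iteration stays in the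
    ball of radius r < 1 and contracts there by the factor r. Two consecutive iterates are kept
    close to z so that the fixed point equation can be tested. *)
Lemma iter_sqrt_cvg A (a : A) (r : R) (y : nat -> A) :
  0 <= r -> r < 1 -> `|a| <= r%:C%C ->
  y 0%N = 0 -> (forall n, y n.+1 = 2^-1 *: (a * a + y n * y n)) ->
  (forall n, `|y n| <= r%:C%C) /\
  exists z : A, forall e : R[i], 0 < e ->
    exists n, `|z - y n| <= e /\ `|z - y n.+1| <= e.
Proof.
move=> r0 r1 ar y0 yS.
have half : `|2^-1 : R[i]| = 2^-1 by rewrite normfV normr_nat.
have r0c : 0 <= r%:C%C :> R[i] by rewrite ler0c.
have r1c : r%:C%C <= 1 :> R[i] by rewrite -(rmorph1 (real_complex R)) lecR ltW.
have yn n : `|y n| <= r%:C%C.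
  elim: n => [|n IH]; first by rewrite y0 normr0.
  rewrite yS normrZ half ler_pdivrMl// mulr_natl mulr2n.
  apply: (le_trans (ler_normD _ _)); apply: lerD.
    apply: (le_trans (le_norm_cstarM _ _)).
    by rewrite -[leRHS]mulr1; apply: ler_pM => //; apply: le_trans _ r1c.
  apply: (le_trans (le_norm_cstarM _ _)).
  by rewrite -[leRHS]mulr1; apply: ler_pM => //; apply: le_trans _ r1c.
split => //.
have yd n : `|y n.+1 - y n| <= (r ^+ n)%:C%C.
  elim: n => [|n IH].
    by rewrite y0 subr0 expr0 rmorph1; exact: le_trans (yn 1%N) r1c.
  (* This splitting of a difference of squares needs no commutativity; both outer factors have norm
     at most r, and the factor 1/2 absorbs their number. *)
  have -> : y n.+2 - y n.+1 =
     2^-1 *: (y n.+1 * (y n.+1 - y n) + (y n.+1 - y n) * y n).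
    rewrite [y n.+2]yS {3}[y n.+1]yS -scalerBr.
    by rewrite opprD addrACA subrr add0r mulrBr mulrBl addrA subrK.
  rewrite normrZ half ler_pdivrMl// mulr_natl mulr2n exprS rmorphM/=.
  apply: (le_trans (ler_normD _ _)); apply: lerD.
    by apply: (le_trans (le_norm_cstarM _ _)); apply: ler_pM.
  by apply: (le_trans (le_norm_cstarM _ _)); rewrite mulrC; apply: ler_pM.
have r1' : 0 < 1 - r by rewrite subr_gt0.
have ydm n m : `|y n - y (n + m)%N| <= (r ^+ n / (1 - r))%:C%C.
  have : `|y n - y (n + m)%N| <= (\sum_(n <= k < n + m) r ^+ k)%:C%C.
    elim: m => [|m IH]; first by rewrite addn0 subrr normr0 big_geq.
    rewrite addnS big_nat_recr/= ?leq_addr// rmorphD/=.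
    have -> : y n - y (n + m).+1 = (y n - y (n + m)%N) + (y (n + m)%N - y (n + m).+1).
      by rewrite addrA subrK.
    apply: (le_trans (ler_normD _ _)); apply: lerD => //.
    by rewrite distrC yd.
  move/le_trans; apply; rewrite lecR -{1}[n]add0n big_addn addKn.
  under eq_bigr do rewrite addnC exprD.
  rewrite -mulr_sumr ler_wpM2l ?exprn_ge0// // -[_^-1]mul1r ler_pdivlMr// mulrC -[1 - r]opprB.
  by rewrite big_mkord mulNr -subrX1 opprB lerBlDr lerDl exprn_ge0.
have small (e : R[i]) : 0 < e -> exists N, forall n, (N <= n)%N ->
    forall m, `|y n - y (n + m)%N| <= e.
  move=> e0; have er : e \is Num.real by rewrite gtr0_real.
  have [s es] : exists s, e = s%:C%C by exists (complex.Re e); rewrite RRe_real.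
  move: e0; rewrite es ltcR => s0.
  have : (fun n => r ^+ n : R^o) @ \oo --> (0 : R^o).
    by apply: cvg_expr; rewrite ger0_norm.
  move/cvgrPdist_lt => /(_ (s * (1 - r)) (mulr_gt0 s0 r1'))[N _ HN].
  exists N => n Nn m; apply: (le_trans (ydm _ _)); rewrite lecR.
  rewrite ler_pdivrMr//; have := HN n Nn; rewrite /= sub0r normrN.
  by rewrite ger0_norm ?exprn_ge0// => /ltW.
have [z yz] : exists z : A, y @ \oo --> z.
  apply/cvg_ex; apply: cauchy_cvg; apply: cauchy_exP => e e0.
  have [N HN] := small (e / 2) (divr_gt0 e0 (ltr0n _ 2)).
  exists (y N); exists N => // n /= Nn; rewrite -ball_normE /=.
  rewrite -(subnKC Nn); apply: le_lt_trans (HN N (leqnn _) _) _.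
  by rewrite ltr_pdivrMr// ltr_pMr// ltr1n.
exists z => e e0; move/cvgrPdist_lt : yz => /(_ e e0)[N _ HN].
by exists N; split; apply: ltW; apply: HN => /=.
Qed.

Lemma sqrt_one_sub_sqr A (a : A) : star a = a -> `|a| < 1 ->
  exists c : A, [/\ star c = c, c * a = a * c & c * c = 1 - a * a].
Proof.
move=> sa a1; pose r := complex.Re `|a|.
have ra : `|a| = r%:C%C by rewrite RRe_real.
have r0 : 0 <= r by rewrite -ler0c -ra.
have r1 : r < 1 by rewrite -ltcR -ra.
have ar : `|a| <= r%:C%C by rewrite ra.
pose y n : A := iter n (fun y => 2^-1 *: (a * a + y * y)) 0.
have yS n : y n.+1 = 2^-1 *: (a * a + y n * y n) by [].
have [yn [z yz]] := iter_sqrt_cvg r0 r1 ar erefl yS.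
have half : `|2^-1 : R[i]| = 2^-1 by rewrite normfV normr_nat.
have r1c : r%:C%C <= 1 :> R[i] by rewrite -(rmorph1 (real_complex R)) lecR ltW.
have ys n : star (y n) = y n.
  elim: n => [|n IH]; first by rewrite star0.
  by rewrite yS starZ starD !cstarM sa IH fmorphV rmorph_nat.
have ya n : y n * a = a * y n.
  elim: n => [|n IH]; first by rewrite mul0r mulr0.
  rewrite yS cstarZl cstarZr mulrDl mulrDr !mulrA; congr (_ *: (_ + _)).
  by rewrite -mulrA IH mulrA IH.
have zs : star z = z.
  apply/eqP; rewrite -subr_eq0; apply/eqP/(@norm_small_eq0 _ _ 2) => e e0.
  have [n [zn _]] := yz e e0.
  have -> : star z - z = star (z - y n) - (z - y n).
    by rewrite cstarB ys opprB addrA subrK.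
  rewrite mulr_natl mulr2n; apply: (le_trans (ler_normB _ _)).
  by rewrite norm_star lerD.
have za : z * a = a * z.
  apply/eqP; rewrite -subr_eq0; apply/eqP/(@norm_small_eq0 _ _ 2) => e e0.
  have [n [zn _]] := yz e e0.
  have -> : z * a - a * z = (z - y n) * a - a * (z - y n).
    by rewrite mulrBl mulrBr ya opprB addrA subrK.
  rewrite mulr_natl mulr2n; apply: (le_trans (ler_normB _ _)).
  apply: lerD; apply: (le_trans (le_norm_cstarM _ _)).
    by rewrite -[leRHS]mulr1; apply: ler_pM => //; exact: ltW.
  by rewrite -[leRHS]mul1r; apply: ler_pM => //; exact: ltW.
have zz : z = 2^-1 *: (a * a + z * z).
  have zr : `|z| <= 2.
    have [n [zn _]] := yz 1 ltr01.
    rewrite -[z](subrK (y n)); apply: (le_trans (ler_normD _ _)).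
    by rewrite -[2](natrD _ 1 1); apply: lerD => //; apply: le_trans _ r1c.
  (* The constant 3 covers e for the distance to [y n.+1] and, before halving, e and 2e for the two
     products, by the crude bound 2 on the norm of z. *)
  apply/eqP; rewrite -subr_eq0; apply/eqP/(@norm_small_eq0 _ _ 3) => e e0.
  have [n [zn zn1]] := yz e e0.
  have -> : z - 2^-1 *: (a * a + z * z) = (z - y n.+1) +
      2^-1 *: (y n * (y n - z) + (y n - z) * z).
    rewrite mulrBr mulrBl addrA subrK.
    have -> : y n * y n - z * z = (a * a + y n * y n) - (a * a + z * z).
      by rewrite opprD addrACA subrr add0r.
    by rewrite scalerBr -yS addrA subrK.
  rewrite mulr_natl mulrS; apply: (le_trans (ler_normD _ _)).
  apply: lerD => //; rewrite normrZ half ler_pdivrMl//.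
  rewrite mulr_natl mulr2n -addrA; apply: (le_trans (ler_normD _ _)); apply: lerD.
    apply: (le_trans (le_norm_cstarM _ _)); rewrite distrC -[leRHS]mul1r.
    by apply: ler_pM => //; apply: le_trans _ r1c.
  apply: (le_trans (le_norm_cstarM _ _)); rewrite distrC mulrC.
  have -> : e + (e + e) = 3 * e by rewrite mulr_natl.
  by apply: ler_pM => //; apply: (le_trans zr); rewrite ler_nat.
exists (1 - z); split.
- by rewrite cstarB star1 zs.
- by rewrite mulrBl mulrBr za mul1r mulr1.
have z2 : z + z = a * a + z * z.
  by rewrite -mulr2n -scaler_nat [in LHS]zz scalerA mulfV ?scale1r// pnatr_eq0.
rewrite mulrBr mulr1 mulrBl mul1r -[a * a](addrK (z * z)) -z2 !opprB opprD -!addrA.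
by rewrite [- z + _]addrCA.
Qed.

(* Automatic continuity without spectral theory: a is the real part of the
   unitary a + i sqrt(1 - a^2), and a unital star-homomorphism preserves
   unitaries. *)
Lemma star_hom_norm_selfadjoint A B (f : A -> B) (a : A) :
  unital_star_hom f -> star a = a -> `|a| < 1 -> `|f a| <= 1.
Proof.
move=> [fl [f1 fM] fs] sa a1; have [c [cs ca cc]] := sqrt_one_sub_sqr sa a1.
have fD (k : R[i]) x y : f (k *: x + y) = k *: f x + f y by rewrite fl.
pose u := 'i *: c + a.
have su : star u = - 'i *: c + a by rewrite starD starZ cs sa conjCi.
have uu : star u * u = 1.
  rewrite su mulrDl !mulrDr !cstarZl !cstarZr scalerA mulNr -expr2 sqrCi opprK.
  by rewrite scale1r ca cc scaleNr addrA addrNK subrK.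
have fu : `|f u| <= 1 by apply: norm_isometry; rewrite -fs -fM uu.
have ua : 2 *: f a = star (f u) + f u.
  rewrite -fs su !fD addrACA -scalerDl addNr scale0r add0r.
  by rewrite -{2 3}(scale1r (f a)) -scalerDl.
rewrite -(@ler_pM2l _ 2)// mulr1 -[2 in leLHS]normr_nat -normrZ ua.
apply: (le_trans (ler_normD _ _)); rewrite norm_star.
by rewrite -[2](natrD _ 1 1) lerD.
Qed.

(** The C*-identity reduces the bound to the self-adjoint element x^* x. Dividing it by its norm
    plus e gives norm strictly below 1, as the self-adjoint case requires, and also covers x = 0. *)
Lemma star_hom_norm A B (f : A -> B) (x : A) :
  unital_star_hom f -> `|f x| <= `|x|.
Proof.
move=> fh; have [fl [f1 fM] fs] := fh.
have fZ (k : R[i]) y : f (k *: y) = k *: f y.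
  have f0 : f 0 = 0.
    by have := fl 1 0 0; rewrite !scale1r addr0 -{1}[f 0]addr0 => /addrI/esym.
  by have := fl k y 0; rewrite f0 !addr0.
rewrite -(@ler_pXn2r _ 2)// ?nnegrE// -!norm_starM -fs -fM.
set a := star x * x; have sa : star a = a by rewrite cstarM starK.
apply/ler_addgt0Pr => e e0; set t := `|a| + e.
have t0 : 0 < t by rewrite ltr_wpDl.
have tr : t^-1^* = t^-1 by rewrite geC0_conj// invr_ge0 ltW.
have : `|f (t^-1 *: a)| <= 1.
  apply: star_hom_norm_selfadjoint => //; first by rewrite starZ tr sa.
  by rewrite normrZ gtr0_norm ?invr_gt0// ltr_pdivrMl// mulr1 /t ltrDl.
by rewrite fZ normrZ gtr0_norm ?invr_gt0// ler_pdivrMl// mulr1.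
Qed.

End CstarBasics.

(** * Functoriality of the crossed product *)

Section StarHoms.
Variable R : realType.
Implicit Types A B D : cstarType R.

Section OneHom.
Variables (A B : cstarType R) (f : A -> B).
Hypothesis fh : unital_star_hom f.

Lemma star_homM x y : f (x * y) = f x * f y.
Proof. by have [_ [_ fM] _] := fh. Qed.

Lemma star_hom1 : f 1 = 1.
Proof. by have [_ [f1 _] _] := fh. Qed.

Lemma star_homS x : f (star x) = star (f x).
Proof. by have [_ _ fs] := fh. Qed.

Lemma star_homZD (c : R[i]) x y : f (c *: x + y) = c *: f x + f y.
Proof. by have [fl _ _] := fh; rewrite fl. Qed.

Lemma star_homD x y : f (x + y) = f x + f y.
Proof. by have := star_homZD 1 x y; rewrite !scale1r. Qed.

Lemma star_hom0 : f 0 = 0.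
Proof. by have := star_homD 0 0; rewrite addr0 -{1}[f 0]addr0 => /addrI. Qed.

Lemma star_homZ (c : R[i]) x : f (c *: x) = c *: f x.
Proof. by have := star_homZD c x 0; rewrite star_hom0 !addr0. Qed.

Lemma star_homB x y : f (x - y) = f x - f y.
Proof. by rewrite -scaleN1r addrC star_homZD scaleN1r addrC. Qed.

Lemma star_hom_sum (I : Type) (r : seq I) (F : I -> A) :
  f (\sum_(i <- r) F i) = \sum_(i <- r) f (F i).
Proof. exact: (big_morph _ star_homD star_hom0). Qed.

Lemma star_homX x n : f (x ^+ n) = f x ^+ n.
Proof. by elim: n => [|n IH]; rewrite ?star_hom1// !exprS star_homM IH. Qed.

Lemma star_hom_continuous : continuous f.
Proof.
move=> x; apply/cvgrPdist_lt => e e0.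
near=> y; rewrite -star_homB; apply: le_lt_trans (star_hom_norm _ fh) _.
by near: y; apply: cvgr_dist_lt.
Unshelve. all: by end_near. Qed.

Lemma closed_preimage_hom (E : set B) : closed E -> closed (f @^-1` E).
Proof.
by move=> cE; apply: preimage_closed => // x _; exact: star_hom_continuous.
Qed.

Lemma linear_preimage_hom (E : set B) :
  linear_subspace E -> linear_subspace (f @^-1` E).
Proof.
move=> [E0 EZD]; split=> [|c x y Ex Ey]; rewrite /preimage/=.
  by rewrite star_hom0.
by rewrite star_homZD; exact: EZD.
Qed.

Lemma cstar_preimage_hom (E : set B) :
  cstar_subalgebra E -> cstar_subalgebra (f @^-1` E).
Proof.
move=> [Ec El EM Es]; split.
- exact: closed_preimage_hom.
- exact: linear_preimage_hom.
- by move=> x y Ex Ey; rewrite /preimage/= star_homM; exact: EM.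
- by move=> x Ex; rewrite /preimage/= star_homS; exact: Es.
Qed.

Lemma ideal_preimage_hom (E : set B) :
  closed_ideal E -> closed_ideal (f @^-1` E).
Proof.
move=> [Ec El Eml Emr]; split.
- exact: closed_preimage_hom.
- exact: linear_preimage_hom.
- by move=> x y Ey; rewrite /preimage/= star_homM; exact: Eml.
- by move=> x y Ey; rewrite /preimage/= star_homM; exact: Emr.
Qed.

Lemma closed_span_hom (G : set A) (G' : set B) : (forall x, G x -> G' (f x)) ->
  forall x, closed_span G x -> closed_span G' (f x).
Proof.
move=> GG' x Gx E [[Ec El] G'E].
apply: (Gx (f @^-1` E)); split; last by move=> y /GG' /G'E.
by split; [exact: closed_preimage_hom|exact: linear_preimage_hom].
Qed.

Lemma cstar_generated_hom (G : set A) (G' : set B) :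
  (forall x, G x -> G' (f x)) ->
  forall x, cstar_generated G x -> cstar_generated G' (f x).
Proof.
move=> GG' x Gx E [Ec G'E].
apply: (Gx (f @^-1` E)); split; last by move=> y /GG' /G'E.
exact: cstar_preimage_hom.
Qed.

Lemma ideal_generated_hom (G : set A) (G' : set B) :
  (forall x, G x -> G' (f x)) ->
  forall x, ideal_generated G x -> ideal_generated G' (f x).
Proof.
move=> GG' x Gx E [Ec G'E].
apply: (Gx (f @^-1` E)); split; last by move=> y /GG' /G'E.
exact: ideal_preimage_hom.
Qed.

End OneHom.

Lemma star_hom_comp A B D (f : A -> B) (g : B -> D) :
  unital_star_hom f -> unital_star_hom g -> unital_star_hom (g \o f).
Proof.
move=> fh gh; split.
- by move=> c x y /=; rewrite (star_homZD fh) (star_homZD gh).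
- split=> [|x y] /=; first by rewrite (star_hom1 fh) (star_hom1 gh).
  by rewrite (star_homM fh) (star_homM gh).
- by move=> x /=; rewrite (star_homS fh) (star_homS gh).
Qed.

Lemma star_hom_inv A B (f : A -> B) (g : B -> A) :
  unital_star_hom f -> cancel f g -> cancel g f -> unital_star_hom g.
Proof.
move=> fh fK gK; split.
- by move=> c x y; rewrite -{1}[x]gK -{1}[y]gK -(star_homZD fh) fK.
- split; first by rewrite -(star_hom1 fh) fK.
  by move=> x y; rewrite -{1}[x]gK -{1}[y]gK -(star_homM fh) fK.
- by move=> x; rewrite -{1}[x]gK -(star_homS fh) fK.
Qed.

Lemma cstar_subalgebra_generated A (G : set A) : cstar_subalgebra (cstar_generated G).
Proof.
split.
- by apply: closed_bigI => E [[]].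
- split=> [E [[_ [E0 _]]]//|c x y Gx Gy E HE].
  by have [[_ [_ EZD] _ _] _] := HE; apply: EZD; [exact: Gx|exact: Gy].
- by move=> x y Gx Gy E HE; have [[_ _ EM _] _] := HE; apply: EM; [exact: Gx|exact: Gy].
- by move=> x Gx E HE; have [[_ _ _ Es] _] := HE; apply: Es; exact: Gx.
Qed.

Lemma cstar_generated_sub A (G : set A) x : G x -> cstar_generated G x.
Proof. by move=> Gx E [_]; exact. Qed.

(** Reduces equality of homomorphisms to generators: the equalizer is one of the candidates in the
    definition of a generated C*-algebra. *)
Lemma cstar_subalgebra_eq A B (f g : A -> B) :
  unital_star_hom f -> unital_star_hom g ->
  cstar_subalgebra [set x | f x = g x].
Proof.
move=> fh gh; split.
- have -> : [set x | f x = g x] = (fun x => f x - g x) @^-1` [set 0].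
    apply/seteqP; split=> x /=; first by move=> ->; rewrite subrr.
    by move/eqP; rewrite subr_eq0 => /eqP.
  apply: preimage_closed => [x _|]; last exact/accessible_closed_set1/hausdorff_accessible/norm_hausdorff.
  by apply: continuousB; exact: star_hom_continuous.
- split=> [|c x y /= fx fy]; first by rewrite /= (star_hom0 fh) (star_hom0 gh).
  by rewrite (star_homZD fh) (star_homZD gh) fx fy.
- by move=> x y /= fx fy; rewrite (star_homM fh) (star_homM gh) fx fy.
- by move=> x /= fx; rewrite (star_homS fh) (star_homS gh) fx.
Qed.

End StarHoms.

Section CrossedProductFunctor.
Variable R : realType.

Section OneCrossedProduct.
Variables (A : cstarType R) (alpha L : A -> A).
Variable O : crossed_product alpha L.

Lemma cp_embed_hom : unital_star_hom (cp_embed O).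
Proof.
apply: star_hom_comp (cp_rho_hom O).
by have [[]] := cp_universal O.
Qed.

Lemma cp_isometry_alpha a :
  cp_isometry O * cp_embed O a = cp_embed O (alpha a) * cp_isometry O.
Proof.
have [[_ H _] _ _] := cp_universal O.
by rewrite -!(star_homM (cp_rho_hom O)) H.
Qed.

Lemma cp_isometry_L a :
  star (cp_isometry O) * cp_embed O a * cp_isometry O = cp_embed O (L a).
Proof.
have [[_ _ H] _ _] := cp_universal O.
by rewrite -(star_homS (cp_rho_hom O)) -!(star_homM (cp_rho_hom O)) H.
Qed.

Lemma cp_surj (x : O) : exists t, x = cp_rho t.
Proof.
have : [set: O] x by [].
by rewrite -cp_rho_surj => -[t _ <-]; exists t.
Qed.

Lemma cp_hom_ext (B : cstarType R) (f g : O -> B) :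
  unital_star_hom f -> unital_star_hom g ->
  (forall a, f (cp_embed O a) = g (cp_embed O a)) ->
  f (cp_isometry O) = g (cp_isometry O) -> f =1 g.
Proof.
move=> fh gh fg fgs x; have [t ->] := cp_surj x.
have fr := star_hom_comp (cp_rho_hom O) fh.
have gr := star_hom_comp (cp_rho_hom O) gh.
have [_ gen _] := cp_universal O.
have : [set: cp_toeplitz O] t by [].
rewrite -gen => /(_ [set u | f (cp_rho u) = g (cp_rho u)]); apply.
split; first exact: (cstar_subalgebra_eq fr gr).
by move=> _ [[a _ <-]|->] /=; [exact: fg|exact: fgs].
Qed.

End OneCrossedProduct.

(** Universality gives theta between the Toeplitz algebras, and theta sends redundancies to
    redundancies. Surjectivity of [h] enters there: a redundancy in the target is tested against
    every element of [A'], and the source only controls those of the form [h b]. *)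
Lemma cp_functor (A A' : cstarType R) (alpha L : A -> A) (alpha' L' : A' -> A')
    (O : crossed_product alpha L) (O' : crossed_product alpha' L')
    (h : A -> A') :
  unital_star_hom h -> (forall a', exists a, a' = h a) ->
  (forall a, h (alpha a) = alpha' (h a)) -> (forall a, h (L a) = L' (h a)) ->
  exists Phi : O -> O', [/\ unital_star_hom Phi,
    (forall a, Phi (cp_embed O a) = cp_embed O' (h a)) &
    Phi (cp_isometry O) = cp_isometry O'].
Proof.
move=> hh hs hal hL.
have [_ _ univ] := cp_universal O.
have [[ih' ia' iL'] _ _] := cp_universal O'.
have [|theta [th thi thS]] := univ (cp_toeplitz O') (cp_iota O' \o h) (cp_S O').
  split; first exact: star_hom_comp ih'.
    by move=> a /=; rewrite ia' hal.
  by move=> a /=; rewrite iL' hL.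
have ker t : cp_rho t = 0 :> O -> cp_rho (theta t) = 0 :> O'.
  move/cp_rho_ker => tK; apply/cp_rho_ker.
  apply: (ideal_generated_hom th) tK => _ [a [k [[kcl kr] acl ->]]].
  exists (h a), (theta k); split; last by rewrite (star_homB th) thi.
  - split.
      apply: (closed_span_hom th) kcl => _ [b [c ->]].
      by exists (h b), (h c); rewrite !(star_homM th) (star_homS th) !thi thS.
    move=> b'; have [b ->] := hs b'.
    have := congr1 theta (kr b).
    by rewrite !(star_homM th) !thi thS.
  - apply: (closed_span_hom hh) acl => _ [b [c [d ->]]].
    by exists (h b), (h c), (h d); rewrite !(star_homM hh) hal.
(* An arbitrary preimage under the quotient map is chosen; [ker] makes the result independent of the
   choice. *)
pose Phi (x : O) : O' := cp_rho (theta (projT1 (cid (cp_surj x)))).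
have PhiE t : Phi (cp_rho t) = cp_rho (theta t).
  rewrite /Phi; case: cid => u /= tu.
  apply/eqP; rewrite -subr_eq0 -(star_homB (cp_rho_hom O')) -(star_homB th).
  by apply/eqP/ker; rewrite (star_homB (cp_rho_hom O)) tu subrr.
have rh := cp_rho_hom O; have rh' := cp_rho_hom O'.
exists Phi; split; last 2 first.
- by move=> a; rewrite PhiE thi.
- by rewrite PhiE thS.
split.
- move=> c x y; have [t ->] := cp_surj x; have [u ->] := cp_surj y.
  by rewrite -(star_homZD rh) !PhiE (star_homZD th) (star_homZD rh').
- split; first by rewrite -(star_hom1 rh) PhiE (star_hom1 th) (star_hom1 rh').
  move=> x y; have [t ->] := cp_surj x; have [u ->] := cp_surj y.
  by rewrite -(star_homM rh) !PhiE (star_homM th) (star_homM rh').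
- move=> x; have [t ->] := cp_surj x.
  by rewrite -(star_homS rh) !PhiE (star_homS th) (star_homS rh').
Qed.

(** The inverse is the same construction applied to [h']; both composites fix the copy of the
    coefficient algebra and rho(S), which generate. *)
Lemma cp_isomorphism (A A' : cstarType R) (alpha L : A -> A)
    (alpha' L' : A' -> A')
    (O : crossed_product alpha L) (O' : crossed_product alpha' L')
    (h : A -> A') (h' : A' -> A) :
  unital_star_hom h -> cancel h h' -> cancel h' h ->
  (forall a, h (alpha a) = alpha' (h a)) -> (forall a, h (L a) = L' (h a)) ->
  exists Phi : O -> O', [/\ star_isomorphism Phi,
    (forall a, Phi (cp_embed O a) = cp_embed O' (h a)) &
    Phi (cp_isometry O) = cp_isometry O'].
Proof.
move=> hh hK h'K hal hL.
have [|Phi [Ph Pi PS]] := cp_functor O O' hh _ hal hL.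
  by move=> a'; exists (h' a'); rewrite h'K.
have hh' := star_hom_inv hh hK h'K.
have [|||Psi [Qh Qi QS]] := @cp_functor _ _ _ _ _ _ O' O h' hh'.
- by move=> a; exists (h a); rewrite hK.
- by move=> a; rewrite -{1}[a]h'K -hal hK.
- by move=> a; rewrite -{1}[a]h'K -hL hK.
have idh (B : cstarType R) : unital_star_hom (@id B) by split=> //; split.
exists Phi; split=> //; split=> //; exists Psi.
- apply: (cp_hom_ext (star_hom_comp Ph Qh) (idh O)) => [a|] /=.
    by rewrite Pi Qi hK.
  by rewrite PS QS.
- apply: (cp_hom_ext (star_hom_comp Qh Ph) (idh O')) => [a|] /=.
    by rewrite Qi Pi h'K.
  by rewrite QS PS.
Qed.

End CrossedProductFunctor.

(** * Generators of D_X *)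

Section Cylinders.
Variable a : finType.

(** The product topology is a supremum of coordinate topologies, so convergence of the prefix filter
    is checked one coordinate at a time; coordinate i is fixed by a prefix of length i + 1. *)
Lemma nbhs_prefix (u : full_shift a) (U : set (full_shift a)) :
  nbhs u U ->
  exists n : nat, forall v : full_shift a, (forall i, (i < n)%N -> v i = u i) -> U v.
Proof.
pose F := filter_from [set: nat]
  (fun n => [set v : full_shift a | forall i, (i < n)%N -> v i = u i]).
have FF : Filter F.
  apply: filter_from_filter; first by exists 0%N.
  move=> m n _ _; exists (maxn m n) => // v vu.
  by split=> i lti; apply: vu; rewrite leq_max lti ?orbT.
suff Fu : F --> u by move=> /Fu[n _ nU]; exists n => v vu; exact: nU.
apply/cvg_sup => i V [W] [[Q] oQ <-] Qu QV.
exists i.+1 => // v /= vu; apply: QV => /=.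
by rewrite /proj vu.
Qed.

Variable X : shift_space a.

Lemma nbhs_prefix_sub (x : X) (U : set X) : nbhs x U ->
  exists n : nat, forall y : X,
    (forall i, (i < n)%N -> set_val y i = set_val x i) -> U y.
Proof.
case=> _ [[V oV <-] Vx VU].
have [|n nV] := @nbhs_prefix (set_val x) V.
  exact: open_nbhs_nbhs.
by exists n => y /nV; exact: VU.
Qed.

Lemma prefix_notin (u : full_shift a) : ~ points X u ->
  exists n : nat, forall x : X, ~ (forall i, (i < n)%N -> set_val x i = u i).
Proof.
move=> Xu; have [|n nX] := @nbhs_prefix u (~` points X).
  by apply: open_nbhs_nbhs; split=> //; apply: closed_openC; exact: points_closed.
by exists n => x /nX; apply; exact: set_valP.
Qed.

End Cylinders.

(** * Uniform approximation of continuous functions by functions of finitely many letters *)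

Section LocallyConstantApproximation.
Variables (R : realType) (a : finType) (X : shift_space a).
Local Notation C := (R[i]^o).
Local Notation B := (bfun R X : cstarType R).

(* If f had no approximation in E, then by finiteness of the alphabet some
   point would have no cylinder around it on which f is nearly constant. *)
Lemma continuous_funs_sub (E : set B) : cstar_subalgebra E -> E 1 ->
  (forall c, E (cylinder R X c)) -> (forall f : bfun R X, E f -> E (alphaB f)) ->
  @continuous_funs R a X `<=` E.
Proof.
move=> EC E1 Ecyl Ealpha f cf.
have [E0 EZD] := csub_linear EC.
have ED g h : E g -> E h -> E (g + h).
  by move=> Eg Eh; rewrite -[g]scale1r; exact: EZD.
have Esum (s : seq a) (g : a -> bfun R X) : (forall c, E (g c)) ->
    exists2 h : bfun R X, E h & forall x, h x = \sum_(c <- s) (g c x : R[i]).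
  move=> Eg; elim: s => [|c s [h Eh hE]].
    by exists (0 : bfun R X) => // x; rewrite big_nil.
  exists (g c + h); first exact: ED.
  by move=> x; rewrite big_cons -hE.
have Ecyln n c : exists2 g : bfun R X, E g &
    forall x : X, g x = (set_val x n == c)%:R.
  elim: n => [|n [g Eg gE]]; first by exists (cylinder R X c).
  exists (alphaB g); first exact: Ealpha.
  by move=> x; rewrite /= gE.
suff approx (e : R[i]) : 0 < e -> exists2 g : bfun R X, E g & forall x, `|f x - g x| <= e.
  apply: (csub_closed EC) => U /nbhs_ballP[e e0 eU].
  have [|g Eg fg] := approx (e / 2); first by rewrite divr_gt0.
  exists g; split=> //; apply: eU; rewrite -ball_normE /=.
  apply: (@le_lt_trans _ _ (e / 2)); last by rewrite ltr_pdivrMr// ltr_pMr// ltr1n.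
  by apply: bfun_norm_le => //; rewrite divr_ge0// ltW.
move=> e0; apply: contrapT => nog.
(* Only the first n letters of u matter; infinite sequences stand for prefixes. *)
pose bad n (u : full_shift a) := ~ exists2 g : bfun R X, E g &
  forall x : X, (forall i, (i < n)%N -> set_val x i = u i) -> `|f x - g x| <= e.
pose upd (u : full_shift a) n c : full_shift a := fun i => if i == n then c else u i.
(* If every one-letter extension had an approximation, then weighting each by the indicator of x_n =
   c and adding over c would approximate f on the whole cylinder. *)
have badS n u : bad n u -> exists c, bad n.+1 (upd u n c).
  move=> badu; apply: contrapT => nobad; apply: badu.
  have good c : exists2 g : bfun R X, E g & forall x : X,
      (forall i, (i < n.+1)%N -> set_val x i = upd u n c i) -> `|f x - g x| <= e.
    by apply: contrapT => badc; apply: nobad; exists c.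
  pose g c := s2val (cid2 (good c)).
  have Eg c : E (g c) by exact: s2valP (cid2 (good c)).
  have gf c := s2valP' (cid2 (good c)).
  pose p c := s2val (cid2 (Ecyln n c)).
  have Ep c : E (p c) by exact: s2valP (cid2 (Ecyln n c)).
  have pE c := s2valP' (cid2 (Ecyln n c)).
  have [q Eq qE] : exists2 q : a -> bfun R X, (forall c, E (q c)) &
      forall c x, q c x = p c x * g c x.
    exists (fun c => bfun_mul (p c) (g c)) => // c.
    exact: csub_mul EC _ _ (Ep c) (Eg c).
  have [h Eh hE] := Esum (index_enum a) q Eq.
  exists h => // x xu; rewrite hE (bigD1 (set_val x n))//= big1 => [|c cx].
    rewrite addr0 qE pE eqxx mul1r; apply: gf => i; rewrite ltnS leq_eqVlt /upd.
    by case: eqP => [->//|_] /= /xu.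
  by rewrite qE pE eq_sym (negbTE cx) mul0r.
(* The construction needs some sequence to start from; on an empty X the zero function already
   approximates. *)
have [[x0 _]|X0] := pselect (exists x : X, True); last first.
  by apply: nog; exists (0 : bfun R X) => // x; case: X0; exists x.
have bad0 : bad 0%N (set_val x0).
  by move=> [g Eg fg]; apply: nog; exists g => // x; exact: fg.
pose nxt n u : a := if pselect (bad n u) is left b then projT1 (cid (badS n u b))
  else u n.
have nxtP n u : bad n u -> bad n.+1 (upd u n (nxt n u)).
  by rewrite /nxt; case: pselect => // b _; exact: projT2 (cid (badS n u b)).
pose v := fix v n : full_shift a :=
  if n is k.+1 then upd (v k) k (nxt k (v k)) else set_val x0.
have vbad n : bad n (v n) by elim: n => [//|n IH]; exact: nxtP.
pose u : full_shift a := fun i => v i.+1 i.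
have vu n i : (i < n)%N -> v n i = u i.
  elim: n => // n IH; rewrite ltnS leq_eqVlt => /orP[/eqP->//|lti].
  by rewrite /= /upd ltn_eqF// IH.
have ubad n : bad n u.
  move=> [g Eg fg]; apply: (vbad n); exists g => // x xv.
  by apply: fg => i lti; rewrite xv// vu.
(* Inside X, continuity at u makes the constant f(u) good on some cylinder. Outside X, closedness of
   X empties some cylinder, and 0 is good there. *)
have [Xu|Xu] := pselect (points X u).
- pose x : X := exist _ u (mem_set Xu).
  have /cvgrPdist_lt/(_ _ e0)/nbhs_prefix_sub[n xn] := cf x.
  have [k Ek kE] : exists2 k : bfun R X, E k & forall y, k y = f x.
    exists ((f x : R[i]) *: (1 : B)); first by rewrite -[_ *: _]addr0; exact: EZD.
    by move=> y; exact: mulr1.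
  apply: (ubad n); exists k => // y yu; rewrite distrC kE.
  by apply/ltW/xn => i lti; rewrite yu.
- have [n xn] := prefix_notin Xu.
  by apply: (ubad n); exists (0 : bfun R X) => // x /xn.
Qed.

End LocallyConstantApproximation.

(** * Pointwise calculus in D_X and an induction principle for it *)

Section DXCalculus.
Variables (R : realType) (a : finType) (X : shift_space a).
Local Notation D := (csub (DX R X) : cstarType R).
Local Notation B := (bfun R X : cstarType R).
Local Notation gen c := (generator_coef R X c : D).
Implicit Types (f g q : D) (x y : X) (c d : a).

Definition dval (f : D) (x : X) : R[i] := bfun_val (csub_val f) x.

Lemma dval_inj f g : dval f =1 dval g -> f = g.
Proof. by move=> fg; apply/val_inj/bfun_eqP. Qed.

Lemma dvalM f g x : dval (f * g) x = dval f x * dval g x.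
Proof. by []. Qed.

Lemma dval1 x : dval 1 x = 1.
Proof. by []. Qed.

Lemma dvalS f x : dval (star f) x = (dval f x)^*.
Proof. by []. Qed.

Lemma dval_alpha f x : dval (alphaD f) x = dval f (sigma x).
Proof. by []. Qed.

Lemma dval_gen c x : dval (gen c) x =
  (set_val x 0%N == c)%:R * sqrtC (nfiber (sigma x))%:R.
Proof. by []. Qed.

Lemma dval_sum (I : Type) (r : seq I) (F : I -> D) x :
  dval (\sum_(i <- r) F i) x = \sum_(i <- r) dval (F i) x.
Proof. by apply: (big_morph (dval^~ x)). Qed.

Lemma DX_mulC f g : f * g = g * f.
Proof. by apply: dval_inj => x; rewrite !dvalM mulrC. Qed.

Definition cylinderD c : D :=
  Csub (introT (in_csubP (DX R X) _) (DX_continuous (@continuous_cylinder R a X c))).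

Lemma dval_cylinder c x : dval (cylinderD c) x = (set_val x 0%N == c)%:R.
Proof. by []. Qed.

Lemma sum_letter (F : a -> R[i]) (b : a) :
  \sum_(c : a) (b == c)%:R * F c = F b.
Proof.
rewrite (bigD1 b)//= eqxx mul1r big1 ?addr0// => c cb.
by rewrite eq_sym (negbTE cb) mul0r.
Qed.

Lemma sum_cylinder : \sum_(c : a) cylinderD c = 1.
Proof.
apply: dval_inj => x; rewrite dval_sum dval1.
under eq_bigr do rewrite dval_cylinder -[_%:R]mulr1.
exact: (sum_letter (fun=> 1)).
Qed.

Lemma mem_fiber x y : (y \in fset_set (fiber x)) = (sigma y == x).
Proof.
rewrite in_fset_set; last exact: finite_fiber.
by apply/idP/eqP => [/set_mem//|yx]; apply/mem_set.
Qed.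

Lemma nfiber_neq0 x : (nfiber (sigma x))%:R != 0 :> R[i].
Proof.
rewrite pnatr_eq0 -lt0n /nfiber cardfs_gt0; apply/fset0Pn.
by exists x; rewrite mem_fiber.
Qed.

Lemma sqrt_nfiber_neq0 x : sqrtC (nfiber (sigma x))%:R != 0 :> R[i].
Proof. by rewrite sqrtC_eq0 nfiber_neq0. Qed.

Lemma dval_transfer q x : dval (transferD q) x =
  (nfiber x)%:R^-1 * \sum_(y <- fset_set (fiber x)) dval q y.
Proof.
rewrite /dval /= /transfer fsbig_finite//; exact: finite_fiber.
Qed.

(** This is x |-> q(cx), with value 0 where cx is not in X: the squared coefficient is the fiber
    count, which cancels the averaging in L. *)
Definition branch c q : D := transferD (star (gen c) * q * gen c).

Lemma dval_branch c q x : dval (branch c q) x =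
  \sum_(y <- fset_set (fiber x)) (set_val y 0%N == c)%:R * dval q y.
Proof.
rewrite dval_transfer mulr_sumr; apply: eq_big_seq => y.
rewrite mem_fiber => /eqP yx.
rewrite !dvalM dvalS !dval_gen yx rmorphM/= conjC_nat.
rewrite geC0_conj ?sqrtC_ge0//.
have n0 := nfiber_neq0 y; rewrite yx in n0.
set n := (nfiber x)%:R in n0 *.
case: eqP => _; last by rewrite !mul0r mulr0.
by rewrite !mul1r mulrAC -expr2 sqrtCK mulKf.
Qed.

Lemma dval_sum_branch q x : dval (\sum_(c : a) branch c q) x =
  \sum_(y <- fset_set (fiber x)) dval q y.
Proof.
rewrite dval_sum; under eq_bigr do rewrite dval_branch.
rewrite exchange_big/=; apply: eq_bigr => y _.
exact: (sum_letter (fun=> dval q y)).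
Qed.

(* The point of the fiber over [sigma x] that starts with [c] is [x] itself,
   if [x] starts with [c]. *)
Lemma cylinder_redundant c q : cylinderD c * q =
  gen c * (alphaD (transferD (star (gen c) * q)) : D).
Proof.
apply: dval_inj => x; rewrite !dvalM dval_alpha dval_cylinder dval_gen.
have [xc|_] := eqVneq (set_val x 0%N) c; last by rewrite !mul0r.
rewrite !mul1r dval_transfer (big_rem x)/=; last by rewrite mem_fiber.
rewrite big1_seq ?addr0 => [|y /= yx].
  rewrite dvalM dvalS dval_gen xc eqxx mul1r geC0_conj ?sqrtC_ge0//.
  rewrite mulrCA !mulrA -(mulrA _^-1) -expr2 sqrtCK.
  by rewrite mulVf ?mul1r// nfiber_neq0.
move: yx; rewrite mem_rem_uniq ?fset_uniq// inE mem_fiber => /andP[yx /eqP sy].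
rewrite dvalM dvalS dval_gen; case: eqP => [yc|_]; last by rewrite mul0r conjC0 mul0r.
by rewrite (@fiber_head a X (sigma x) y x) ?eqxx// in yx; rewrite yc xc.
Qed.

(** The coefficient is alpha(f)^(-1/2). The fiber over sigma(x) contains x, so its count is at least
    1, and the finitely many possible counts keep the inverse root in D by interpolation. *)
Lemma isometry_coef : exists r : D,
  r * \sum_(c : a) gen c = 1.
Proof.
have rb : (fun x : X => (sqrtC (nfiber (sigma x))%:R)^-1 : R[i]^o) \in @is_bounded R X.
  apply/asboolP; exists 1 => x; rewrite normfV ger0_norm ?sqrtC_ge0//.
  rewrite invf_le1 ?sqrtC_gt0 ?ltr0n.
    by rewrite -[leLHS]sqrtC1 ler_sqrtC ?nnegrE// ler1n lt0n -(pnatr_eq0 R[i]) nfiber_neq0.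
  by rewrite lt0n -(pnatr_eq0 R[i]) nfiber_neq0.
have rD : (BFun rb : B) \in in_csub (DX R X).
  apply/in_csubP; apply: (csub_finite_calculus (h := fun z : R[i]^o => (z : R[i])^-1)
    (s := [seq sqrtC (n%:R : R[i]) | n <- iota 0 #|a|.+1]) (f := sqrt_alpha_nfiber R X)).
  - exact: DX_cstar.
  - exact: DX_one.
  - exact: DX_sqrt_alpha_nfiber.
  - by move=> x; apply: (map_f (fun n => sqrtC n%:R)); rewrite mem_iota/= add0n ltnS leq_nfiber.
  - by [].
exists (Csub rD); apply: dval_inj => x; rewrite dvalM dval_sum dval1.
under eq_bigr do rewrite dval_gen.
rewrite (sum_letter (fun=> sqrtC (nfiber (sigma x))%:R)).
by rewrite -[dval _ x]/((sqrtC (nfiber (sigma x))%:R)^-1) mulVf// sqrt_nfiber_neq0.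
Qed.

(** Minimality of [DX_set] is about sets of bounded functions, while inductions on D use sets of
    elements of the subalgebra. The image stays closed because D is closed and carries the ambient
    norm. *)
Lemma csub_image_cstar (E : set D) : cstar_subalgebra E ->
  cstar_subalgebra ((@csub_val _ _ _) @` E : set B).
Proof.
move=> [Ec [E0 EZD] EM Es]; split.
- move=> f clf.
  have fD : f \in in_csub (DX R X).
    apply/in_csubP; apply: (csub_closed (@DX_cstar R a X)) => U fU.
    have [_ [[g Eg <-] Ug]] := clf U fU.
    by exists (csub_val g); split=> //; exact: (csubP (g : csub (DX R X))).
  exists (Csub fD) => //; apply: Ec => U /nbhs_ballP[e e0 eU].
  have [_ [[g Eg <-] fg]] := clf _ (nbhsx_ballx f e e0).
  by exists g; split=> //; apply: eU; move: fg; rewrite -!ball_normE.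
- split; first by exists 0.
  by move=> c _ _ [f Ef <-] [g Eg <-]; exists (c *: f + g) => //; exact: EZD.
- by move=> _ _ [f Ef <-] [g Eg <-]; exists (f * g) => //; exact: EM.
- by move=> _ [f Ef <-]; exists (star f) => //; exact: Es.
Qed.

(** Adding [branch c q] over all letters gives the unweighted sum of q over a fiber, and q = 1 gives
    the fiber count; dividing recovers L. The letter maps replace L because in the crossed product
    they are compressions by the S_c. *)
Lemma DX_ind (E : set D) : cstar_subalgebra E -> E 1 ->
  (forall c, E (cylinderD c)) -> (forall q, E q -> E (alphaD q)) ->
  (forall c q, E q -> E (branch c q)) -> forall q, E q.
Proof.
move=> EC E1 Ecyl Ealpha Ebranch.
pose E' : set B := (@csub_val _ _ _) @` E.
have EC' : cstar_subalgebra E' := csub_image_cstar EC.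
have E1' : E' 1 by exists 1.
have [E0 EZD] := csub_linear EC.
have Esum (F : a -> D) : (forall c, E (F c)) -> E (\sum_(c : a) F c).
  move=> EF; apply: big_ind => // f g Ef Eg.
  by rewrite -[f]scale1r; exact: EZD.
suff DE : @DX_set R a X `<=` E'.
  move=> q; have [q' Eq' q'q] := DE _ (csubP q).
  by rewrite (_ : q = q')//; apply: val_inj.
move=> f; apply; split; last first.
  apply: continuous_funs_sub => // [c|_ [g Eg <-]]; first by exists (cylinderD c).
  by exists (alphaD g) => //; exact: Ealpha.
split=> // [_ [_ [g Eg <-] <-]|_ [_ [g Eg <-] <-]].
  by exists (alphaD g) => //; exact: Ealpha.
(* Over an empty fiber the inverse of 0 is 0, in agreement with L vanishing there. *)
have ib : (fun x : X => (nfiber x)%:R^-1 : R[i]^o) \in @is_bounded R X.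
  apply/asboolP; exists 1 => x; rewrite normfV normr_nat.
  have [->|n0] := eqVneq (nfiber x) 0%N; first by rewrite invr0 ler01.
  by rewrite invf_le1 ?ltr0n ?lt0n// ler1n lt0n.
have Ei : E' (BFun ib).
  pose N : D := \sum_(c : a) branch c 1.
  have NE x : bfun_val (csub_val N) x = (nfiber x)%:R.
    have := dval_sum_branch 1 x; rewrite /dval => ->.
    by rewrite big_const_seq count_predT iter_addr_0.
  apply: (csub_finite_calculus (h := fun z : R[i]^o => (z : R[i])^-1)
    (s := [seq (n%:R : R[i]^o) | n <- iota 0 #|a|.+1]) (f := csub_val N)) => //.
  - by exists N => //; apply: Esum => c; exact: Ebranch.
  - by move=> x; rewrite NE nfiber_values// leq_nfiber.
  - by move=> x; rewrite NE.
have -> : transferB (csub_val g) = (BFun ib : B) * csub_val (\sum_(c : a) branch c g).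
  apply: bfun_eqP => x.
  by have := dval_transfer g x; rewrite -dval_sum_branch.
apply: (csub_mul EC' Ei); exists (\sum_(c : a) branch c g) => //.
by apply: Esum => c; exact: Ebranch.
Qed.

End DXCalculus.

(** * Letters, core and gauge action *)

Lemma cstar_mul_continuous (R : realType) (A : cstarType R) (a b : A) :
  continuous (fun x : A => a * x * b).
Proof.
move=> x; apply/cvgrPdist_lt => e e0; pose K := `|a| * `|b| + 1.
have K0 : 0 < K by rewrite ltr_wpDl// mulr_ge0.
near=> y; rewrite -mulrBl -mulrBr.
apply: (@le_lt_trans _ _ (K * `|x - y|)).
  apply: (le_trans (le_norm_cstarM _ _)).
  apply: (le_trans (ler_wpM2r (normr_ge0 _) (le_norm_cstarM _ _))).
  by rewrite mulrAC ler_wpM2r// /K lerDl ler01.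
rewrite -ltr_pdivlMl//; near: y; apply: cvgr_dist_lt => //.
by rewrite mulrC divr_gt0.
Unshelve. all: by end_near. Qed.

Section CrossedProductCalculus.
Variables (R : realType) (a : finType) (X : shift_space a).
Variable O : shift_crossed_product R X.
Local Notation D := (csub (DX R X) : cstarType R).
Local Notation gen c := (generator_coef R X c : D).
Local Notation iota := (cp_embed O).
Local Notation s := (cp_isometry O).
Local Notation S := (S_letter O).
Local Notation W := (S_word O).
Implicit Types (f g q r : D) (c d : a) (u v w : seq a).

Let ih : unital_star_hom iota := cp_embed_hom O.

Lemma S_letterE c : S c = iota (gen c) * s.
Proof. by rewrite /S_letter (star_homM (cp_rho_hom O)). Qed.

Lemma S_letter_star c : star (S c) = star s * iota (star (gen c)).
Proof. by rewrite S_letterE cstarM (star_homS ih). Qed.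

Lemma S_letter_embed c q : S c * iota q = iota (alphaD q) * S c.
Proof.
rewrite S_letterE -mulrA cp_isometry_alpha !mulrA -!(star_homM ih).
by rewrite (DX_mulC (gen c)).
Qed.

Lemma S_letter_branch c q : star (S c) * iota q * S c = iota (branch c q).
Proof.
rewrite S_letter_star S_letterE -cp_isometry_L !(star_homM ih).
by rewrite !mulrA.
Qed.

(** Let g be the coefficient of S_c and k = g S S^* g^*. Then k q S = g S L(g^* q) = g alpha(L(g^*
    q)) S, which is the cylinder function times q S by [cylinder_redundant]; so the two form a
    redundancy. *)
Lemma S_letter_range c : S c * star (S c) = iota (cylinderD R X c).
Proof.
have [[ioh ialpha iL] _ _] := cp_universal O.
set io := cp_iota O in ioh ialpha iL *; set t := cp_S O in ialpha iL *.
have rh := cp_rho_hom O.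
pose k := io (gen c) * t * star t * io (star (gen c)).
have rk : cp_rho (io (cylinderD R X c) - k) = 0 :> O.
  apply/cp_rho_ker => E [_]; apply; exists (cylinderD R X c), k; split=> //.
    split=> [F [_]|q]; first by apply; exists (gen c), (star (gen c)).
    have -> : k * io q * t = io (gen c) * (t * (star t * io (star (gen c) * q) * t)).
      by rewrite (star_homM ioh) !mulrA.
    rewrite iL ialpha mulrA -!(star_homM ioh); congr (io _ * _).
    exact: cylinder_redundant.
  (* As alpha is unital, the cylinder function is itself times alpha(1) times 1. *)
  move=> F [_]; apply; exists (cylinderD R X c), 1, 1.
  rewrite mulr1 (_ : (alphaD _ : D) = 1) ?mulr1//.
  exact: dval_inj.
apply/esym/eqP; rewrite -subr_eq0 -rk (star_homB rh); apply/eqP; congr (_ - _).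
by rewrite S_letter_star S_letterE !(star_homM rh) (star_homS rh) !mulrA.
Qed.

Lemma sum_S_letter_range : \sum_(c : a) S c * star (S c) = 1.
Proof.
under eq_bigr do rewrite S_letter_range.
by rewrite -(star_hom_sum ih) sum_cylinder (star_hom1 ih).
Qed.

Lemma embed_alpha q : iota (alphaD q) = \sum_(c : a) S c * iota q * star (S c).
Proof.
under eq_bigr do rewrite S_letter_embed -mulrA.
by rewrite -mulr_sumr sum_S_letter_range mulr1.
Qed.

Lemma isometry_S_letter : exists r, s = iota r * \sum_(c : a) S c.
Proof.
have [r r1] := isometry_coef R X; exists r.
under eq_bigr do rewrite S_letterE.
by rewrite -mulr_suml -(star_hom_sum ih) mulrA -(star_homM ih) r1 (star_hom1 ih) mul1r.
Qed.

Lemma S_letter_partial_isometry c : S c * star (S c) * S c = S c.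
Proof.
rewrite S_letter_range S_letterE mulrA -(star_homM ih); congr (iota _ * _).
apply: dval_inj => x; rewrite dvalM dval_cylinder dval_gen.
by case: eqP; rewrite ?mul1r ?mul0r.
Qed.

Lemma S_word_nil : W [::] = 1.
Proof. by rewrite /S_word big_nil. Qed.

Lemma S_word_cons c u : W (c :: u) = S c * W u.
Proof. by rewrite /S_word big_cons. Qed.

Lemma S_word_rcons u c : W (rcons u c) = W u * S c.
Proof. by rewrite /S_word -cats1 big_cat big_seq1. Qed.

Lemma S_word_embed u q : exists q', W u * iota q = iota q' * W u.
Proof.
elim: u q => [|c u IH] q; first by exists q; rewrite S_word_nil mul1r mulr1.
have [q' qq'] := IH q; exists (alphaD q').
by rewrite S_word_cons -mulrA qq' !mulrA S_letter_embed.
Qed.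

Lemma S_word_compress u q : exists q', star (W u) * iota q * W u = iota q'.
Proof.
elim: u q => [|c u IH] q.
  by exists q; rewrite S_word_nil star1 mul1r mulr1.
have [q' qq'] := IH (branch c q); exists q'.
by rewrite S_word_cons cstarM -qq' -S_letter_branch !mulrA.
Qed.

Lemma S_word_range u : exists p, W u * star (W u) = iota p.
Proof.
elim: u => [|c u [p IH]].
  by exists 1; rewrite S_word_nil star1 mulr1 (star_hom1 ih).
exists ((alphaD p : D) * cylinderD R X c).
rewrite S_word_cons cstarM mulrA -(mulrA (S c)) IH S_letter_embed -mulrA.
by rewrite S_letter_range -(star_homM ih).
Qed.

Lemma embedC f g : iota f * iota g = iota g * iota f.
Proof. by rewrite -!(star_homM ih) DX_mulC. Qed.

(** A product of partial isometries is one when the source projection of the left factor commutes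
    with the range projection of the right factor. Here both projections lie in the commutative
    algebra D. *)
Lemma S_word_partial_isometry u : W u * star (W u) * W u = W u.
Proof.
elim: u => [|c u IH]; first by rewrite S_word_nil star1 !mulr1.
have [p up] := S_word_range u.
rewrite S_word_cons cstarM.
have -> : S c * W u * (star (W u) * star (S c)) * (S c * W u) =
    S c * (W u * star (W u) * (star (S c) * S c)) * W u by rewrite !mulrA.
have -> : star (S c) * S c = iota (branch c 1).
  by rewrite -S_letter_branch (star_hom1 ih) mulr1.
rewrite up embedC -up -[iota _]mulr1 -(star_hom1 ih) -S_letter_branch.
rewrite (star_hom1 ih) !mulr1.
have -> : S c * (star (S c) * S c * (W u * star (W u))) * W u =
    S c * star (S c) * S c * (W u * star (W u) * W u) by rewrite !mulrA.
by rewrite S_letter_partial_isometry IH.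
Qed.

Lemma S_word_isometry u : exists q, W u = iota q * s ^+ size u.
Proof.
elim: u => [|c u [q IH]].
  by exists 1; rewrite S_word_nil (star_hom1 ih) mulr1.
exists (gen c * alphaD q).
rewrite S_word_cons IH S_letterE exprS (star_homM ih) !mulrA.
by rewrite -(mulrA _ s) cp_isometry_alpha !mulrA.
Qed.

(** * A description of the core F_X free of letters *)

Let FXC : cstar_subalgebra (FX O) := cstar_subalgebra_generated _.

Lemma FX_sum (I : finType) (F : I -> O) :
  (forall i, FX O (F i)) -> FX O (\sum_i F i).
Proof.
move=> FF; have [F0 FZD] := csub_linear FXC.
by apply: big_ind => // x y Fx Fy; rewrite -[x]scale1r; exact: FZD.
Qed.

(* Quantifying over u makes this set invariant under q |-> S_c^* q S_c by
   construction. *)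
Definition core_stable : set D := [set q | forall u v w, size v = size w ->
  FX O (W v * (star (W u) * iota q * W u) * star (W w))].

(** Compression of D by W(u) is multiplicative because W(u) W(u)^* lies in the commutative D.
    Inserting W(v)^* W(v) then splits the product into a factor for the pair v, v and one for v, w;
    both pairs have equal lengths. *)
Lemma core_stable_mul q r : core_stable q -> core_stable r -> core_stable (q * r).
Proof.
move=> Eq Er u v w vw.
have [q' uq] := S_word_compress u q; have [r' ur] := S_word_compress u r.
have [p up] := S_word_range u.
have -> : star (W u) * iota (q * r) * W u = iota q' * iota r'.
  have Wp : star (W u) * iota p = star (W u).
    by rewrite -up -[in RHS](S_word_partial_isometry u) !cstarM starK.
  have -> : iota q' * iota r' =
      star (W u) * (iota q * (W u * star (W u))) * iota r * W u.
    by rewrite -uq -ur !mulrA.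
  by rewrite up embedC !mulrA Wp (star_homM ih) !mulrA.
have [p' vp] := S_word_compress v 1.
have -> : W v * (iota q' * iota r') * star (W w) =
    (W v * iota q' * star (W v)) * (W v * iota r' * star (W w)).
  have vv : star (W v) * W v = iota p' by rewrite -vp (star_hom1 ih) mulr1.
  have -> : (W v * iota q' * star (W v)) * (W v * iota r' * star (W w)) =
      W v * (iota q' * (star (W v) * W v)) * iota r' * star (W w).
    by rewrite !mulrA.
  rewrite vv (embedC q' p') -vv !mulrA.
  by rewrite S_word_partial_isometry.
apply: (csub_mul FXC).
  by rewrite -uq; exact: Eq.
by rewrite -ur; exact: Er.
Qed.

Lemma core_stable_cstar : cstar_subalgebra core_stable.
Proof.
split.
- have -> : core_stable = \bigcap_(p in [set p : seq a * seq a * seq a |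
      size p.1.2 = size p.2]) [set q | FX O (W p.1.2 *
      (star (W p.1.1) * iota q * W p.1.1) * star (W p.2))].
    apply/seteqP; split=> [q Eq [[u v] w] /= vw|q Eq u v w vw]; first exact: Eq.
    exact: (Eq (u, v, w)).
  apply: closed_bigI => -[[u v] w] /= vw.
  apply: (@preimage_closed _ _ (fun q : D => W v * (star (W u) * iota q * W u) * star (W w)));
    last exact: csub_closed FXC.
  move=> q _; apply: (@continuous_comp _ _ _
    (fun q : D => star (W u) * iota q * W u) (fun x => W v * x * star (W w)));
    last exact: cstar_mul_continuous.
  apply: (@continuous_comp _ _ _ iota (fun x => star (W u) * x * W u));
    last exact: cstar_mul_continuous.
  exact: star_hom_continuous.
- have [F0 FZD] := csub_linear FXC.
  split=> [u v w vw|k q r Eq Er u v w vw].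
    by rewrite (star_hom0 ih) mulr0 mul0r mulr0 mul0r.
  rewrite (star_homZD ih) mulrDr mulrDl cstarZr cstarZl.
  rewrite mulrDr mulrDl cstarZr cstarZl.
  by apply: FZD; [exact: Eq|exact: Er].
- exact: core_stable_mul.
- move=> q Eq u v w vw.
  have -> : W v * (star (W u) * iota (star q) * W u) * star (W w) =
      star (W w * (star (W u) * iota q * W u) * star (W v)).
    by rewrite !cstarM !starK (star_homS ih) !mulrA.
  by apply: (csub_star FXC); exact: Eq.
Qed.

Lemma FX_generator u v w : size v = size w ->
  FX O (W v * star (W u) * W u * star (W w)).
Proof. by move=> vw; apply: cstar_generated_sub; exists u, v, w. Qed.

Lemma core_stable1 : core_stable 1.
Proof.
move=> u v w vw; rewrite (star_hom1 ih) mulr1 !mulrA.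
exact: FX_generator.
Qed.

Lemma core_stable_branch c q : core_stable q -> core_stable (branch c q).
Proof.
move=> Eq u v w vw; have := Eq (c :: u) v w vw.
by rewrite S_word_cons cstarM -S_letter_branch !mulrA.
Qed.

(** For empty u, the terms S_c S_c^* and S_c r S_c^* are absorbed by appending c to both v and w.
    For u starting with d, compression by S_d turns a cylinder function into 0 or S_d^* S_d, and
    alpha(r) into S_d^* S_d r. *)
Lemma core_stableT q : core_stable q.
Proof.
have [F0 FZD] := csub_linear FXC.
apply: (DX_ind core_stable_cstar core_stable1); last exact: core_stable_branch.
- move=> c [|d u] v w vw.
    rewrite S_word_nil star1 mul1r mulr1 -S_letter_range mulrA -mulrA -cstarM.
    rewrite -!S_word_rcons.
    have := @FX_generator [::] (rcons v c) (rcons w c).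
    by rewrite S_word_nil star1 !mulr1; apply; rewrite !size_rcons vw.
  have -> : star (W (d :: u)) * iota (cylinderD R X c) * W (d :: u) =
      star (W u) * iota (branch d (cylinderD R X c)) * W u.
    by rewrite S_word_cons cstarM -S_letter_branch !mulrA.
  have [->|cd] := eqVneq c d; last first.
    rewrite (_ : branch _ _ = (0 : D)); last first.
      apply: dval_inj => x; rewrite dval_branch big1// => y _.
      rewrite dval_cylinder; case: eqP => [->|_]; last by rewrite mul0r.
      by rewrite eq_sym (negbTE cd) mulr0.
    by rewrite (star_hom0 ih) mulr0 mul0r mulr0 mul0r.
  rewrite (_ : branch _ _ = branch d 1); last first.
    apply: dval_inj => x; rewrite !dval_branch; apply: eq_bigr => y _.
    by rewrite dval_cylinder dval1; case: eqP => [|_]; rewrite ?mul1r ?mul0r.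
  by have H := @core_stable_branch d 1 core_stable1; exact: H.
- move=> r Er [|d u] v w vw.
    rewrite S_word_nil star1 mul1r mulr1 embed_alpha mulr_sumr mulr_suml.
    apply: FX_sum => c.
    have := Er [::] (rcons v c) (rcons w c).
    rewrite S_word_nil star1 mul1r mulr1 !S_word_rcons cstarM !mulrA.
    by apply; rewrite !size_rcons vw.
  have -> : star (W (d :: u)) * iota (alphaD r) * W (d :: u) =
      star (W u) * iota (branch d (alphaD r)) * W u.
    by rewrite S_word_cons cstarM -S_letter_branch !mulrA.
  rewrite (_ : branch _ _ = (branch d 1 : D) * r).
    have H := core_stable_mul (@core_stable_branch d 1 core_stable1) Er.
    exact: H.
  apply: dval_inj => x; rewrite dvalM !dval_branch mulr_suml.
  apply: eq_big_seq => y; rewrite mem_fiber => /eqP yx.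
  by rewrite dval_alpha yx dval1 mulr1.
Qed.

Lemma FX_embed q : FX O (iota q).
Proof.
have := @core_stableT q [::] [::] [::] erefl.
by rewrite S_word_nil star1 !mulr1 !mul1r.
Qed.

Definition core_generators : set O :=
  [set x | exists n q, x = s ^+ n * iota q * star (s ^+ n)].

Lemma core_generators_FX x : core_generators x -> FX O x.
Proof.
move=> [n [q ->]].
(* The flanking words make the induction work: the outermost rho(S) on each side becomes a
   coefficient times a sum of letters, the coefficient moves left past the word, and the letters
   lengthen v and w by one each. *)
suff H v w : size v = size w ->
    FX O (W v * (s ^+ n * iota q * star (s ^+ n)) * star (W w)).
  by have := H [::] [::] erefl; rewrite S_word_nil star1 mulr1 mul1r.
elim: n v w => [|n IH] v w vw.
  rewrite expr0 star1 mul1r mulr1.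
  have := @core_stableT q [::] v w vw.
  by rewrite S_word_nil star1 mul1r mulr1.
have [r sr] := isometry_S_letter.
have [rv vr] := S_word_embed v r; have [rw wr] := S_word_embed w r.
have Ws u r' : W u * iota r = iota r' * W u ->
    W u * s ^+ n.+1 = iota r' * (\sum_(c : a) W (rcons u c)) * s ^+ n.
  move=> ur; rewrite exprS mulrA; congr (_ * _).
  rewrite {1}sr mulrA ur -mulrA; congr (_ * _).
  by rewrite mulr_sumr; apply: eq_bigr => c _; rewrite S_word_rcons.
have -> : W v * (s ^+ n.+1 * iota q * star (s ^+ n.+1)) * star (W w) =
    W v * s ^+ n.+1 * iota q * star (W w * s ^+ n.+1).
  by rewrite cstarM !mulrA.
rewrite (Ws v rv vr) (Ws w rw wr) !cstarM.
set t := s ^+ n; set A := \sum_c W _; set A' := \sum_c W _.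
have -> : iota rv * A * t * iota q * (star t * (star A' * star (iota rw))) =
    iota rv * (A * (t * iota q * star t) * star A') * iota (star rw).
  by rewrite (star_homS ih) !mulrA.
apply: (csub_mul FXC); last exact: FX_embed.
apply: (csub_mul FXC); first exact: FX_embed.
rewrite star_sum !mulr_suml; apply: FX_sum => c.
rewrite mulr_sumr; apply: FX_sum => d.
by apply: IH; rewrite !size_rcons vw.
Qed.

Lemma FX_core : FX O = cstar_generated core_generators.
Proof.
have GC : cstar_subalgebra (cstar_generated core_generators).
  exact: cstar_subalgebra_generated.
have Gi q : cstar_generated core_generators (iota q).
  by apply: cstar_generated_sub; exists 0%N, q; rewrite expr0 star1 mul1r mulr1.
apply/seteqP; split=> x Fx.
- apply: Fx; split=> // _ [u [v [w [vw ->]]]].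
  have [p vp] := S_word_isometry v; have [r wr] := S_word_isometry w.
  have [q uq] := S_word_compress u 1.
  (* Equal lengths of v and w give the same power of rho(S) on both sides. *)
  have -> : W v * star (W u) * W u * star (W w) =
      iota p * (s ^+ size v * iota q * star (s ^+ size v)) * iota (star r).
    rewrite -uq (star_hom1 ih) mulr1 wr cstarM -vw {1}vp (star_homS ih).
    by rewrite !mulrA.
  apply: (csub_mul GC) => //; apply: (csub_mul GC) => //.
  by apply: cstar_generated_sub; exists (size v), q.
- by apply: Fx; split=> // y; exact: core_generators_FX.
Qed.

(** * The gauge action on D and on rho(S) *)

Section Gauge.
Variables (z : R[i]) (gam : O -> O).
Hypotheses (z1 : `|z| = 1) (gh : unital_star_hom gam).
Hypothesis gamW : forall u, gam (W u) = z ^+ size u *: W u.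

Let zz : z * z^* = 1.
Proof. by rewrite -normCK z1 expr1n. Qed.

Let gamS c : gam (S c) = z *: S c.
Proof.
have := gamW [:: c]; rewrite /= expr1.
by rewrite !S_word_cons S_word_nil mulr1.
Qed.

(** In each operation that generates D, a letter occurs together with its adjoint, so the factors z
    and z^* cancel. *)
Lemma gauge_embed q : gam (iota q) = iota q.
Proof.
pose E : set D := [set q | (gam \o iota) q = iota q].
have EC : cstar_subalgebra E.
  by apply: cstar_subalgebra_eq => //; exact: star_hom_comp gh.
apply: (DX_ind EC) => [|c|r /= Er|c r /= Er]; rewrite /E/=.
- by rewrite (star_hom1 ih) (star_hom1 gh).
- rewrite -S_letter_range (star_homM gh) (star_homS gh) gamS starZ.
  by rewrite cstarZl cstarZr scalerA zz scale1r.
- rewrite embed_alpha (star_hom_sum gh); apply: eq_bigr => c _.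
  rewrite !(star_homM gh) (star_homS gh) gamS [gam (iota r)]Er starZ.
  by rewrite !cstarZl cstarZr scalerA zz scale1r.
- rewrite -S_letter_branch !(star_homM gh) (star_homS gh) gamS [gam (iota r)]Er starZ.
  by rewrite !cstarZl cstarZr scalerA mulrC zz scale1r.
Qed.

Lemma gauge_isometry : gam s = z *: s.
Proof.
have [r sr] := isometry_S_letter.
rewrite [in LHS]sr (star_homM gh) gauge_embed (star_hom_sum gh).
under eq_bigr do rewrite gamS.
by rewrite -scaler_sumr cstarZr -sr.
Qed.

End Gauge.

End CrossedProductCalculus.

(** * Conjugacies *)

Lemma dval_sum_gen (R : realType) (a : finType) (X : shift_space a) (x : X) :
  dval (\sum_(c : a) (generator_coef R X c : (csub (DX R X) : cstarType R))) x =
  sqrtC (nfiber (sigma x))%:R.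
Proof.
rewrite dval_sum; under eq_bigr do rewrite dval_gen.
exact: (sum_letter (fun=> sqrtC (nfiber (sigma x))%:R)).
Qed.

Lemma sum_S_letterE (R : realType) (a : finType) (X : shift_space a)
    (O : shift_crossed_product R X) : \sum_(c : a) S_letter O c =
  cp_embed O (\sum_(c : a) (generator_coef R X c : (csub (DX R X) : cstarType R)))
    * cp_isometry O.
Proof.
under eq_bigr do rewrite S_letterE.
by rewrite -mulr_suml (star_hom_sum (cp_embed_hom O)).
Qed.

Section Pullback.
Variables (R : realType) (a b : finType) (X : shift_space a) (Y : shift_space b).
Variables (phi : X -> Y) (psi : Y -> X).
Hypotheses (phiK : cancel phi psi) (psiK : cancel psi phi).
Hypothesis psi_continuous : continuous psi.
Hypothesis psi_sigma : forall y, psi (sigma y) = sigma (psi y).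

Lemma perm_fiber y :
  perm_eq (fset_set (fiber (psi y))) (map psi (fset_set (fiber y))).
Proof.
apply: uniq_perm; first exact: fset_uniq.
  by rewrite map_inj_uniq ?fset_uniq//; exact: can_inj psiK.
move=> x; rewrite mem_fiber; apply/eqP/mapP => [xy|[y' + ->]].
  exists (phi x); last by rewrite phiK.
  by rewrite mem_fiber -(inj_eq (can_inj psiK)) psi_sigma phiK xy.
by rewrite mem_fiber -psi_sigma => /eqP ->.
Qed.

Lemma nfiber_conjugate y : nfiber (psi y) = nfiber y.
Proof. by rewrite /nfiber (perm_size (perm_fiber y)) size_map. Qed.

Lemma is_bounded_pullback (f : bfun R X) :
  (fun y => f (psi y)) \in @is_bounded R Y.
Proof.
by have /asboolP[M HM] := bfun_boundedP f; apply/asboolP; exists M.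
Qed.

Definition pullback (f : bfun R X) : bfun R Y := BFun (is_bounded_pullback f).

Lemma pullback_hom :
  unital_star_hom (pullback : (bfun R X : cstarType R) -> (bfun R Y : cstarType R)).
Proof.
split.
- by move=> c f g; exact: bfun_eqP.
- by split=> [|f g]; exact: bfun_eqP.
- by move=> f; exact: bfun_eqP.
Qed.

Lemma pullback_alpha f : pullback (alphaB f) = alphaB (pullback f).
Proof. by apply: bfun_eqP => y /=; rewrite psi_sigma. Qed.

Lemma pullback_transfer f : pullback (transferB f) = transferB (pullback f).
Proof.
apply: bfun_eqP => y /=; rewrite /transfer !fsbig_finite; try exact: finite_fiber.
by rewrite nfiber_conjugate (perm_big _ (perm_fiber y)) big_map.
Qed.

Lemma pullback_continuous f : continuous_funs f -> continuous_funs (pullback f).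
Proof.
move=> cf y; apply: (@continuous_comp _ _ _ psi f); first exact: psi_continuous.
exact: cf.
Qed.

(** The functions with pullback in D_Y form one of the sets among which D_X is the smallest. *)
Lemma pullback_DX f : @DX_set R a X f -> @DX_set R b Y (pullback f).
Proof.
have [DC Da Dt] := @DX_setP R b Y.
move=> /(_ (pullback @^-1` @DX_set R b Y)); apply; split; last first.
  by move=> g /pullback_continuous; exact: DX_continuous.
split; first exact: cstar_preimage_hom pullback_hom _ DC.
- move=> _ [g Dg <-]; rewrite /preimage/= pullback_alpha.
  by apply: Da; exists (pullback g).
- move=> _ [g Dg <-]; rewrite /preimage/= pullback_transfer.
  by apply: Dt; exists (pullback g).
Qed.

Lemma pullbackD_subproof (f : csub (DX R X)) :
  pullback (csub_val f) \in in_csub (DX R Y).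
Proof. by apply/in_csubP; apply: pullback_DX; exact: (csubP f). Qed.

Definition pullbackD (f : csub (DX R X)) : csub (DX R Y) :=
  Csub (pullbackD_subproof f).

Lemma dval_pullback f y : dval (pullbackD f) y = dval f (psi y).
Proof. by []. Qed.

Lemma pullbackD_hom : unital_star_hom
  (pullbackD : (csub (DX R X) : cstarType R) -> (csub (DX R Y) : cstarType R)).
Proof.
split.
- by move=> c f g; apply: val_inj; exact: (star_homZD pullback_hom).
- split=> [|f g]; apply: val_inj; first exact: (star_hom1 pullback_hom).
  exact: (star_homM pullback_hom).
- by move=> f; apply: val_inj; exact: (star_homS pullback_hom).
Qed.

Lemma pullbackD_alpha f : pullbackD (alphaD f) = alphaD (pullbackD f).
Proof. exact/val_inj/pullback_alpha. Qed.

Lemma pullbackD_transfer f : pullbackD (transferD f) = transferD (pullbackD f).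
Proof. exact/val_inj/pullback_transfer. Qed.

Lemma pullbackD_sum_gen :
  pullbackD (\sum_(c : a) (generator_coef R X c : (csub (DX R X) : cstarType R))) =
  \sum_(d : b) (generator_coef R Y d : (csub (DX R Y) : cstarType R)).
Proof.
apply: dval_inj => y; rewrite dval_pullback !dval_sum_gen.
by rewrite -psi_sigma nfiber_conjugate.
Qed.

End Pullback.

(** The models are arbitrary, as a crossed product is determined only up to isomorphism. Since alpha
    acts on D and not on the crossed product, compatibility with it is expressed by one [g] that
    names both images. *)
Theorem theorem19 (R : realType) (a b : finType)
    (X : shift_space a) (Y : shift_space b)
    (OX : shift_crossed_product R X) (OY : shift_crossed_product R Y) :
  conjugate X Y ->
  exists Phi : OX -> OY,
    star_isomorphism Phi /\
    Phi @` CX_image OX = CX_image OY /\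
    Phi @` DX_image OX = DX_image OY /\
    Phi @` FX OX = FX OY /\
    (forall f : csub (DX R X), exists g : csub (DX R Y),
      Phi (cp_embed OX f) = cp_embed OY g /\
      Phi (cp_embed OX (alphaD f)) = cp_embed OY (alphaD g)) /\
    (forall (gammaX : R[i] -> OX -> OX) (gammaY : R[i] -> OY -> OY),
      gauge_action OX gammaX -> gauge_action OY gammaY ->
      forall z : R[i], `|z| = 1 -> forall x, Phi (gammaX z x) = gammaY z (Phi x)) /\
    (forall x, Phi (LX x) = LX (Phi x)) /\
    (forall x, FX OX x -> Phi (lambdaX x) = lambdaX (Phi x)).
Proof.
move=> [phi [psi [phiK psiK phic psic phis]]].
have psis y : psi (sigma y) = sigma (psi y).
  by rewrite -{1}[y]psiK -phis phiK.
pose h : csub (DX R X) -> csub (DX R Y) := pullbackD phiK psiK psic psis.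
pose h' : csub (DX R Y) -> csub (DX R X) := pullbackD psiK phiK phic phis.
have hK : cancel h h'.
  by move=> f; apply: dval_inj => x; rewrite !dval_pullback phiK.
have h'K : cancel h' h.
  by move=> f; apply: dval_inj => x; rewrite !dval_pullback psiK.
have hal f : h (alphaD f) = alphaD (h f) by exact: pullbackD_alpha.
have hL f : h (transferD f) = transferD (h f) by exact: pullbackD_transfer.
have [Phi [[Ph Pb] Pi PS]] :=
  cp_isomorphism OX OY (pullbackD_hom R phiK psiK psic psis : unital_star_hom h) hK h'K hal hL.
have [Psi PhiK PsiK] := Pb.
have Qh := star_hom_inv Ph PhiK PsiK.
have Qi g : Psi (cp_embed OY g) = cp_embed OX (h' g).
  by rewrite -{1}[g]h'K -Pi PhiK.
have QS : Psi (cp_isometry OY) = cp_isometry OX by rewrite -PS PhiK.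
have Psum : Phi (\sum_(c : a) S_letter OX c) = \sum_(d : b) S_letter OY d.
  rewrite !sum_S_letterE (star_homM Ph) Pi PS; congr (cp_embed OY _ * _).
  exact: pullbackD_sum_gen.
exists Phi; split; first by split.
split; last split; last split; last split; last split; last split.
- apply/seteqP; split=> [_ [_ [f cf <-] <-]|_ [g cg <-]].
    by rewrite Pi; exists (h f) => //; exact: pullback_continuous.
  exists (cp_embed OX (h' g)); last by rewrite Pi h'K.
  by exists (h' g) => //; exact: pullback_continuous.
- apply/seteqP; split=> [_ [_ [f _ <-] <-]|_ [g _ <-]].
    by rewrite Pi; exists (h f).
  by exists (cp_embed OX (h' g)); [exists (h' g)|rewrite Pi h'K].
- rewrite !FX_core; apply/seteqP; split=> [_ [x Fx <-]|y Fy].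
    apply: (cstar_generated_hom Ph) Fx => _ [n [q ->]]; exists n, (h q).
    by rewrite !(star_homM Ph) (star_homS Ph) (star_homX Ph) Pi PS.
  exists (Psi y); last exact: PsiK.
  apply: (cstar_generated_hom Qh) Fy => _ [n [q ->]]; exists n, (h' q).
  by rewrite !(star_homM Qh) (star_homS Qh) (star_homX Qh) Qi QS.
- by move=> f; exists (h f); rewrite !Pi hal.
- move=> gX gY gaX gaY z z1.
  have [[gXh _] gXW] := gaX z z1; have [[gYh _] gYW] := gaY z z1.
  (* Words of X and Y cannot be compared, so the two composites are compared on D and rho(S)
     instead. *)
  apply: (cp_hom_ext (star_hom_comp gXh Ph) (star_hom_comp Ph gYh)) => [q|] /=.
    by rewrite (gauge_embed z1 gXh gXW) Pi (gauge_embed z1 gYh gYW).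
  rewrite (gauge_isometry z1 gXh gXW) (star_homZ Ph) PS.
  by rewrite (gauge_isometry z1 gYh gYW).
- by move=> x; rewrite /LX !(star_homM Ph) (star_homS Ph) PS.
- by move=> x _; rewrite /lambdaX -!star_sum !(star_homM Ph) (star_homS Ph) Psum.
Qed.
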